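(* Let $n=-3\widetilde{n}=-3p_1\cdots p_t$ with primes $p_i\neq 2,3$. Let $$C_4=\begin{pmatrix} 1 & 0 & 0 & 0 & 0 & 0 & O & O\\ 0 & 0 & 0 & 0 & 1 & 0 & O & O\\ 0 & 1 & 0 & 0 & 0 & 0 & O & O\\ 0 & 0 & 0 & 1 & 0 & 1 & O & r_{-1}\\ 1 & 1 & [\frac{-3}{\widetilde{n}}] & 0 & 0 & 0 & r_{-3} & O\\ 0 & 0 & [\frac{-3}{\widetilde{n}}] & 1 & 1 & 1+[\frac{-3}{\widetilde{n}}] & O & r_{-3}\\ O & O & O & r_{-1}^T & r_{2}^T & r_{3}^T & D_{-3} & A+D_{-3}\\ r_{-1}^T & r_{2}^T & r_{3}^T & O & O & O & A+D_{3} & O \end{pmatrix},\quad C_5=\begin{pmatrix} 1 & 0 & 0 & 0 & 0 & 0 & O & O\\ 0 & 1 & 0 & 1 & 0 & 1 & O & r_{-1}\\ 0 & 0 & 0 & 0 & 1 & 0 & O & O\\ 1 & 1 & 1 & 0 & 0 & 1 & r_{-1} & r_2\\ 1 & 1 & [\frac{-3}{\widetilde{n}}] & 0 & 0 & 0 & r_{-3} & O\\ 0 & 0 & [\frac{-3}{\widetilde{n}}] & 1 & 1 & 1+[\frac{-3}{\widetilde{n}}] & O & r_{-3}\\ O & O & O & r_{-1}^T & r_{2}^T & r_{3}^T & D_{-3} & A+D_{-3}\\ r_{-1}^T & r_{2}^T & r_{3}^T & O & O & O & A+D_{3} & O \end{pmatrix},$$ $$C_6=\begin{pmatrix} 1 &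 0 & 0 & 0 & 0 & 0 & O & O\\ 0 & 1 & 0 & 0 & 0 & 0 & O & O\\ 0 & 0 & 0 & 0 & 1 & 0 & O & O\\ 1 & 0 & 1 & 0 & 0 & 0 & r_{-1} & O\\ 1 & 1 & [\frac{-3}{\widetilde{n}}] & 0 & 0 & 0 & r_{-3} & O\\ 0 & 0 & [\frac{-3}{\widetilde{n}}] & 1 & 1 & 1+[\frac{-3}{\widetilde{n}}] & O & r_{-3}\\ O & O & O & r_{-1}^T & r_{2}^T & r_{3}^T & D_{-3} & A+D_{-3}\\ r_{-1}^T & r_{2}^T & r_{3}^T & O & O & O & A+D_{3} & O \end{pmatrix}.$$ Then the Monsky matrix of $E_n$ is $$M_n=\begin{cases} C_4, &\text{if } \widetilde{n}\equiv 1\pmod{8},\\ C_5, &\text{if } \widetilde{n}\equiv 5\pmod{8}, \\ C_6, &\text{if } \widetilde{n}\equiv 3\pmod{4}. \end{cases}$$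
   Context: Let $n$ be a nonzero squarefree integer and $E_n: y^2=x(x+3n)(x-n)$ (the curve attached to $\pi/3$-congruent numbers, twisted by $n$). Write $\widetilde{n}=|n/\gcd(6,n)|=p_1\cdots p_t$ with primes $p_i\neq 2,3$. Every element of $\mathrm{Sel}_2(E_n)$ is represented by a pair $(b_1,b_2)$ with $b_1=(-1)^{\gamma_1}2^{\gamma_2}3^{\gamma_3}\prod_i p_i^{x_i}$, $b_2=(-1)^{\xi_1}2^{\xi_2}3^{\xi_3}\prod_i p_i^{y_i}$, exponents in $\{0,1\}$, encoded by $v^T=(\xi_1,\xi_2,\xi_3,\gamma_1,\gamma_2,\gamma_3,y_1,\dots,y_t,x_1,\dots,x_t)\in\mathbb{F}_2^{2t+6}$. A Monsky matrix of $E_n$ is a matrix $M_n$ over $\mathbb{F}_2$ such that this encoding is a bijection between $\mathrm{Sel}_2(E_n)$ and $\{v: M_nv=0\}$. $[\frac{a}{p}]=\frac12(1-(\frac{a}{p}))\in\mathbb{F}_2$ is the additive Legendre symbol, $[\frac{a}{\widetilde n}]=\sum_i[\frac{a}{p_i}]$. For $d$ coprime to $\widetilde{n}$, $r_d=([\frac{d}{p_1}],\dots,[\frac{d}{p_t}])$ (row vector) and $D_d=\mathrm{diag}(r_d)$. $A=(a_{ij})$ is the $t\times t$ matrix over $\mathbb{F}_2$ with $a_{ij}=[\frac{p_j}{p_i}]$ for $i\neq j$, $a_{ii}=\sum_{j\neq i}a_{ij}$. $O$ denotes a zero block. *)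

(* Defs.v *)
From HB Require Import structures.
From mathcomp Require Import all_boot all_order all_algebra fraction.
From mathcomp Require Import boolp classical_sets functions reals.

Set Implicit Arguments.
Unset Strict Implicit.
Unset Printing Implicit Defensive.

Import Order.TTheory GRing.Theory Num.Theory.
Local Open Scope ring_scope.

(* Z_p as the inverse limit of the Z/p^k, the class modulo p^k being given by
   its representative in [0, p^k); Q_p is the fraction field of Z_p. *)
Record padic_int (p : nat) (p_pr : prime p) := PadicInt {
  residue :> nat -> int;
  residue_coherent : forall k, residue k = (residue k.+1 %% (p ^ k)%N%:Z)%Z
}.

Section PadicIntegers.
Variables (p : nat) (p_pr : prime p).

Local Notation pk k := ((p ^ k)%N%:Z).

Local Notation Zp := (padic_int p_pr).

HB.instance Definition _ := gen_eqMixin Zp.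
HB.instance Definition _ := gen_choiceMixin Zp.

Fact padic_dvd_pkS k : (pk k %| pk k.+1)%Z.
Proof. by rewrite expnS PoszM dvdz_mull. Qed.

Fact padic_modz_pkS (m : int) k : ((m %% pk k.+1)%Z %% pk k)%Z = (m %% pk k)%Z.
Proof.
rewrite {2}(divz_eq m (pk k.+1)); have /dvdzP [q ->] := padic_dvd_pkS k.
by rewrite mulrA modzMDl.
Qed.

Lemma padic_intP (x y : Zp) : (forall k, x k = y k) -> x = y.
Proof.
case: x y => [x hx] [y hy] /= /funext exy; subst y.
by rewrite (Prop_irrelevance hx hy).
Qed.

Lemma residue_mod (x : Zp) k : (x k %% pk k)%Z = x k.
Proof. by rewrite residue_coherent modz_mod. Qed.

Fact trunc_coherent (f : nat -> int) :
    (forall k, (f k.+1 %% pk k)%Z = (f k %% pk k)%Z) ->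
  forall k, (f k %% pk k)%Z = ((f k.+1 %% pk k.+1)%Z %% pk k)%Z.
Proof. by move=> hf k; rewrite padic_modz_pkS hf. Qed.

Fact const_coherent (c : int) k : (c %% pk k)%Z = (c %% pk k)%Z.
Proof. by []. Qed.

Fact add_coherent (x y : Zp) k :
  ((x k.+1 + y k.+1) %% pk k)%Z = ((x k + y k) %% pk k)%Z.
Proof. by rewrite (residue_coherent x k) (residue_coherent y k) modzDm. Qed.

Fact opp_coherent (x : Zp) k :
  ((- x k.+1) %% pk k)%Z = ((- x k) %% pk k)%Z.
Proof. by rewrite (residue_coherent x k) modzNm. Qed.

Fact mul_coherent (x y : Zp) k :
  ((x k.+1 * y k.+1) %% pk k)%Z = ((x k * y k) %% pk k)%Z.
Proof. by rewrite (residue_coherent x k) (residue_coherent y k) modzMm. Qed.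

Definition padic_of_int (c : int) := @PadicInt p p_pr _ (trunc_coherent (const_coherent c)).
Definition padic_add (x y : Zp) :=
  @PadicInt p p_pr _ (trunc_coherent (add_coherent x y)).
Definition padic_opp (x : Zp) :=
  @PadicInt p p_pr _ (trunc_coherent (opp_coherent x)).
Definition padic_mul (x y : Zp) :=
  @PadicInt p p_pr _ (trunc_coherent (mul_coherent x y)).

Fact padic_addA : associative padic_add.
Proof. by move=> x y z; apply: padic_intP => k /=; rewrite modzDmr modzDml addrA. Qed.

Fact padic_addC : commutative padic_add.
Proof. by move=> x y; apply: padic_intP => k /=; rewrite addrC. Qed.

Fact padic_add0 : left_id (padic_of_int 0) padic_add.
Proof. by move=> x; apply: padic_intP => k /=; rewrite mod0z add0r residue_mod. Qed.

Fact padic_addN : left_inverse (padic_of_int 0) padic_opp padic_add.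
Proof. by move=> x; apply: padic_intP => k /=; rewrite modzDml addNr. Qed.

HB.instance Definition _ := GRing.isZmodule.Build Zp
  padic_addA padic_addC padic_add0 padic_addN.

Fact padic_mulA : associative padic_mul.
Proof. by move=> x y z; apply: padic_intP => k /=; rewrite modzMmr modzMml mulrA. Qed.

Fact padic_mulC : commutative padic_mul.
Proof. by move=> x y; apply: padic_intP => k /=; rewrite mulrC. Qed.

Fact padic_mul1 : left_id (padic_of_int 1) padic_mul.
Proof. by move=> x; apply: padic_intP => k /=; rewrite modzMml mul1r residue_mod. Qed.

Fact padic_mulD : left_distributive padic_mul padic_add.
Proof.
by move=> x y z; apply: padic_intP => k /=; rewrite modzMml modzDm mulrDl.
Qed.

Fact padic_1neq0 : padic_of_int 1 != 0.
Proof.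
apply/eqP => /(congr1 (fun x : Zp => x 1)) /=.
by rewrite expn1 mod0z modz_small //= ltz_nat prime_gt1.
Qed.

HB.instance Definition _ := GRing.Zmodule_isComNzRing.Build Zp
  padic_mulA padic_mulC padic_mul1 padic_mulD padic_1neq0.

Definition padic_unit : {pred Zp} := [pred x | `[< exists y : Zp, y * x = 1 >]].

Definition padic_inv (x : Zp) : Zp :=
  if pselect (exists y : Zp, y * x = 1) is left h
  then projT1 (cid h) else x.

Fact padic_mulVx : {in padic_unit, left_inverse 1 padic_inv *%R}.
Proof.
move=> x /asboolP ux; rewrite /padic_inv.
by case: pselect => // h; case: cid.
Qed.

Fact padic_unitPl (x y : Zp) : y * x = 1 -> padic_unit x.
Proof. by move=> yx; apply/asboolP; exists y. Qed.

Fact padic_inv_out : {in [predC padic_unit], padic_inv =1 id}.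
Proof.
by move=> x /negP ux; rewrite /padic_inv; case: pselect => // h; case: ux; apply/asboolP.
Qed.

HB.instance Definition _ := GRing.ComNzRing_hasMulInverse.Build Zp
  padic_mulVx padic_unitPl padic_inv_out.

Lemma residue_modD (x : Zp) i j : (x (i + j)%N %% pk i)%Z = x i.
Proof.
elim: j => [|j IHj]; first by rewrite addn0 residue_mod.
rewrite -IHj (residue_coherent x (i + j)) addnS.
rewrite {1}(divz_eq (x (i + j).+1) (pk (i + j))) [(p ^ (i + j))%N]expnD mulnC PoszM.
by rewrite mulrA modzMDl.
Qed.

Lemma padic_neq0P (x : Zp) : x != 0 -> exists i, x i != 0.
Proof.
move=> x0; apply: contrapT => h; case/eqP: x0; apply: padic_intP => k /=.
rewrite mod0z; apply/eqP/negPn/negP => xk; by apply: h; exists k.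
Qed.

Fact padic_integral (x y : Zp) : x * y = 0 -> (x == 0) || (y == 0).
Proof.
move=> xy0; apply/negPn/negP; rewrite negb_or => /andP[x0 y0].
have [i xi] := padic_neq0P x0; have [j yj] := padic_neq0P y0.
have hx : ~~ ((p ^ i)%N %| `|x (i + j)%N|)%N.
  apply: contra xi; rewrite -[(p ^ i)%N]/(`|pk i|)%N -dvdzE => /dvdz_mod0P.
  by rewrite residue_modD => ->.
have hy : ~~ ((p ^ j)%N %| `|y (i + j)%N|)%N.
  apply: contra yj; rewrite addnC -[(p ^ j)%N]/(`|pk j|)%N -dvdzE => /dvdz_mod0P.
  by rewrite residue_modD => ->.
have : ((p ^ (i + j))%N %| `|x (i + j)%N| * `|y (i + j)%N|)%N.
  rewrite -abszM -[(p ^ (i + j))%N]/(`|pk (i + j)|)%N -dvdzE; apply/dvdz_mod0P.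
  by have /(congr1 (fun z : Zp => z (i + j)%N)) /= := xy0; rewrite mod0z.
move: hx hy; set a := `|_|%N; set b := `|_|%N.
have [->|a0] := posnP a; first by rewrite dvdn0.
have [->|b0] := posnP b; first by rewrite dvdn0.
rewrite !pfactor_dvdn ?muln_gt0 ?a0 ?b0 // lognM // -!ltnNge => ha hb.
by rewrite leqNgt -addnS leq_add // ltnW.
Qed.

HB.instance Definition _ :=
  GRing.ComUnitRing_isIntegral.Build Zp padic_integral.

Definition Qp := {fraction Zp}.
HB.instance Definition _ := GRing.Field.on Qp.

End PadicIntegers.

(* Complete 2-descent on E : y^2 = (x - e1)(x - e2)(x - e3). *)
Section Selmer.
Variables (R : realType) (e1 e2 e3 : rat).

(* The curve in P^3 given by x - e1 = b1 (z1/z0)^2, x - e2 = b2 (z2/z0)^2 and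
   x - e3 = b1 b2 (z3/z0)^2 (with x eliminated): the 2-covering of E attached to
   (b1, b2) in H^1(Q, E[2]) = (Q^*/Q^*2)^2. *)
Definition covering_has_point (K : fieldType) (b1 b2 : rat) : Prop :=
  exists z0 z1 z2 z3 : K,
    [/\ [|| z0 != 0, z1 != 0, z2 != 0 | z3 != 0],
        ratr b1 * z1 ^+ 2 - ratr b2 * z2 ^+ 2 = ratr (e2 - e1) * z0 ^+ 2
      & ratr b1 * z1 ^+ 2 - ratr (b1 * b2) * z3 ^+ 2 = ratr (e3 - e1) * z0 ^+ 2].

Definition everywhere_locally_soluble (b1 b2 : rat) : Prop :=
  covering_has_point R b1 b2 /\
  forall (p : nat) (p_pr : prime p), covering_has_point (Qp p_pr) b1 b2.

(* The coset b Q^*2, for b <> 0. *)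
Definition square_class (b : rat) : set rat :=
  [set a | exists2 c : rat, c != 0 & a = b * c ^+ 2]%classic.

Definition Sel2 : set (set rat * set rat) :=
  [set s | exists b1 b2 : rat,
     [/\ b1 != 0, b2 != 0, everywhere_locally_soluble b1 b2
       & s = (square_class b1, square_class b2)]]%classic.

End Selmer.

(* Sel_2 of E_n : y^2 = x (x + 3n) (x - n). The roots are taken in the order
   0, n, -3n, so that b1 is the class of x and b2 that of x - n. *)
Definition Sel2_E (R : realType) (n : int) : set (set rat * set rat) :=
  Sel2 R 0 n%:~R (- 3 * n)%:~R.

Definition legendre (a : int) (p : nat) : int :=
  if (p %| a)%Z then 0
  else if [exists x : 'F_p, x ^+ 2 == a%:~R] then 1 else -1.

Definition legendre_add (a : int) (p : nat) : 'F_2 :=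
  ((1 - legendre a p) %/ 2)%Z%:~R.

Section Monsky.
Variables (t : nat) (p : 'I_t -> nat).

(* v = (xi_1, xi_2, xi_3, gamma_1, gamma_2, gamma_3, y_1 .. y_t, x_1 .. x_t) *)
Section Decode.
Variable v : 'cV['F_2]_(6 + (t + t)).

Local Definition expo (k : nat) : nat := v (lshift (t + t) (inord k)) 0.
Local Definition y_expo (i : 'I_t) : nat := v (rshift 6 (lshift t i)) 0.
Local Definition x_expo (i : 'I_t) : nat := v (rshift 6 (rshift t i)) 0.

Definition decode_b1 : rat :=
  (-1) ^+ expo 3 * 2 ^+ expo 4 * 3 ^+ expo 5 * \prod_(i < t) (p i)%:R ^+ x_expo i.
Definition decode_b2 : rat :=
  (-1) ^+ expo 0 * 2 ^+ expo 1 * 3 ^+ expo 2 * \prod_(i < t) (p i)%:R ^+ y_expo i.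

End Decode.

(* The p i are meant to be the distinct primes other than 2 and 3 dividing n. *)
Definition is_Monsky_matrix (R : realType) (n : int)
    (M : 'M['F_2]_(6 + (t + t))) : Prop :=
  set_bij [set v : 'cV['F_2]_(6 + (t + t)) | M *m v = 0]%classic (Sel2_E R n)
    (fun v => (square_class (decode_b1 v), square_class (decode_b2 v))).

Definition r_ (d : int) : 'rV['F_2]_t := \row_i legendre_add d (p i).

Definition D_ (d : int) : 'M['F_2]_t := diag_mx (r_ d).

(* [d / (p_1 ... p_t)] *)
Definition legendre_tilde (d : int) : 'F_2 := \sum_i legendre_add d (p i).

Definition A_ : 'M['F_2]_t :=
  \matrix_(i, j) if i == j then \sum_(k | k != i) legendre_add (p k) (p i)
                 else legendre_add (p j) (p i).

Definition C_lower_left : 'M['F_2]_(t + t, 6) :=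
  (\matrix_(j < 6) nth 0 [:: row_mx 0 (r_ (-1)); row_mx 0 (r_ 2); row_mx 0 (r_ 3);
                             row_mx (r_ (-1)) 0; row_mx (r_ 2) 0; row_mx (r_ 3) 0]
                     j)^T.

Definition C_lower_right : 'M['F_2]_(t + t) :=
  block_mx (D_ (-3)) (A_ + D_ (-3)) (A_ + D_ 3) 0.

(* The first six rows are given by their first 6 and their last 2t entries. *)
Definition C_matrix (ul : seq (seq 'F_2)) (ur : seq 'rV['F_2]_(t + t)) :
    'M['F_2]_(6 + (t + t)) :=
  block_mx (\matrix_(i < 6, j < 6) nth 0 (nth [::] ul i) j)
           (\matrix_(i < 6) nth 0 ur i)
           C_lower_left C_lower_right.

Local Notation s := (legendre_tilde (-3)).

Definition C4 : 'M['F_2]_(6 + (t + t)) := C_matrix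
  [:: [:: 1; 0; 0; 0; 0; 0];
      [:: 0; 0; 0; 0; 1; 0];
      [:: 0; 1; 0; 0; 0; 0];
      [:: 0; 0; 0; 1; 0; 1];
      [:: 1; 1; s; 0; 0; 0];
      [:: 0; 0; s; 1; 1; 1 + s]]
  [:: row_mx 0 0;
      row_mx 0 0;
      row_mx 0 0;
      row_mx 0 (r_ (-1));
      row_mx (r_ (-3)) 0;
      row_mx 0 (r_ (-3))].

Definition C5 : 'M['F_2]_(6 + (t + t)) := C_matrix
  [:: [:: 1; 0; 0; 0; 0; 0];
      [:: 0; 1; 0; 1; 0; 1];
      [:: 0; 0; 0; 0; 1; 0];
      [:: 1; 1; 1; 0; 0; 1];
      [:: 1; 1; s; 0; 0; 0];
      [:: 0; 0; s; 1; 1; 1 + s]]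
  [:: row_mx 0 0;
      row_mx 0 (r_ (-1));
      row_mx 0 0;
      row_mx (r_ (-1)) (r_ 2);
      row_mx (r_ (-3)) 0;
      row_mx 0 (r_ (-3))].

Definition C6 : 'M['F_2]_(6 + (t + t)) := C_matrix
  [:: [:: 1; 0; 0; 0; 0; 0];
      [:: 0; 1; 0; 0; 0; 0];
      [:: 0; 0; 0; 0; 1; 0];
      [:: 1; 0; 1; 0; 0; 0];
      [:: 1; 1; s; 0; 0; 0];
      [:: 0; 0; s; 1; 1; 1 + s]]
  [:: row_mx 0 0;
      row_mx 0 0;
      row_mx 0 0;
      row_mx (r_ (-1)) 0;
      row_mx (r_ (-3)) 0;
      row_mx 0 (r_ (-3))].

End Monsky.

(* Main.v *)
(* A class lies in the Selmer group iff its 2-covering is soluble over R and every Q_p.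
   A pair (b1, b2) that is soluble at a prime p not dividing 6n has even valuations at p,
   and conversely a pair of units at such a p is always soluble: by a character sum the
   coverings of the reduced curve all have as many points as the curve itself. At an odd
   p dividing n the soluble classes are exactly the images of the 2-torsion points, which
   are read off by valuations modulo p^3 and Hensel's lemma; at 3 and 2 they are found by
   a finite search modulo 27 and 16; over R the condition is b2 > 0. In terms of the
   exponents of b1 and b2 these conditions are linear over F_2, by the multiplicativity
   of the Legendre symbol and the values of [-1/p], [2/p], [-3/p]: they are the rows of
   the matrix. *)
From mathcomp Require Import all_boot all_order all_algebra all_field.
From mathcomp Require Import cyclic.
From mathcomp Require Import zify ring lra.
From mathcomp Require Import boolp classical_sets reals.
Require Import Defs.

Set Implicit Arguments.
Unset Strict Implicit.
Unset Printing Implicit Defensive.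

Import Order.TTheory GRing.Theory Num.Theory.
Local Open Scope ring_scope.

(** * Quadratic characters of finite fields *)

(** No group law or cohomology enters: at each place both inclusions are proved by hand. Necessity
    scales a point of the covering to a primitive integral solution modulo a power of p. Sufficiency
    exhibits an abscissa X for which b1 X, b2 (X - n) and b1 b2 (X + 3n) are squares, or uses the
    point at infinity. The local images explain the shape of the matrices. The classes of the points
    of order 2 with abscissas 0, n, -3n are (-3, -n), (n, 1), (-3n, -n). At the p_i and at 3 they
    fill the image, of codimension 2 among the square classes. Over Q_2 the image has order 8 in a
    space of dimension 6, so torsion is not enough and three conditions remain; over R there is one.
    Altogether 1 + 3 + 2 + 2t = 2t + 6 rows, in this order: real, 2-adic, 3-adic, then the p_i. *)

Definition is_sq (F : finFieldType) (x : F) : bool := [exists y : F, y ^+ 2 == x].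

Definition qchi (F : finFieldType) (x : F) : int :=
  if x == 0 then 0 else if is_sq x then 1 else -1.

Lemma is_sqP (F : finFieldType) (x : F) : reflect (exists y, x = y ^+ 2) (is_sq x).
Proof. by apply: (iffP existsP) => -[y]; [move/eqP<- | move->]; exists y. Qed.

Lemma finField_prim_root (F : finFieldType) :
  exists z : F, (#|F|.-1).-primitive_root z.
Proof.
have F0 := ltnW (finNzRing_gt1 F); have F1 : (0 < #|F|.-1)%N by rewrite -ltnS prednK // finNzRing_gt1.
have /hasP[z _ zP] : has (#|F|.-1).-primitive_root (enum [pred x : F | x != 0]).
  apply: has_prim_root => //.
  - apply/allP => x; rewrite mem_enum inE unity_rootE => x0.
    by rewrite -(inj_eq (mulfI x0)) mulr1 -exprS prednK ?expf_card.
  - exact: enum_uniq.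
  rewrite -cardE; have := cardC1 (0 : F) => cF.
  by rewrite -cF leq_eqVlt; apply/orP; left; apply/eqP/eq_card => x; rewrite !inE.
by exists z.
Qed.

Lemma prim_root_neq0 (R : idomainType) n (z : R) : n.-primitive_root z -> z != 0.
Proof.
move=> zP; apply/eqP => z0; have := prim_expr_order zP.
by rewrite z0 expr0n eqn0Ngt (prim_order_gt0 zP) => /eqP; rewrite eq_sym oner_eq0.
Qed.

Section QuadraticCharacter.
Variable F : finFieldType.
Hypothesis oddF : odd #|F|.

Let h := #|F|.-1./2.

Lemma card_half : #|F|.-1 = h.*2.
Proof. by move: oddF; rewrite /h; lia. Qed.

Lemma card_half_gt0 : (0 < h)%N.
Proof. have F1 := finNzRing_gt1 F; by rewrite -double_gt0 -card_half -ltnS prednK // ltnW. Qed.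

Lemma prim_root_half (z : F) : (#|F|.-1).-primitive_root z -> z ^+ h = -1.
Proof.
move=> zP; have : (z ^+ h - 1) * (z ^+ h + 1) == 0.
  by rewrite -subr_sqr expr1n -exprM muln2 -card_half (prim_expr_order zP) subrr.
rewrite mulf_eq0 subr_eq0 -(prim_order_dvd zP) => /orP[|].
  by have := card_half_gt0; move=> h0 /(dvdn_leq h0); rewrite card_half; lia.
by rewrite addr_eq0 => /eqP.
Qed.

Lemma two_neq0 : 2 != 0 :> F.
Proof.
have [z zP] := finField_prim_root F; apply/negP => /eqP F2.
have : z ^+ h == 1.
  by rewrite prim_root_half // -subr_eq0 -opprD oppr_eq0 -[1 + 1]/(2 : F) F2.
rewrite -(prim_order_dvd zP) => /(dvdn_leq card_half_gt0).
by have := card_half_gt0; rewrite card_half; lia.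
Qed.

Lemma unit_prim_root (z x : F) : (#|F|.-1).-primitive_root z -> x != 0 ->
  exists i, x = z ^+ i.
Proof.
move=> zP x0; have [|i ->] := @prim_rootP _ _ _ zP x; last by exists i.
apply: (mulfI x0); rewrite mulr1 -exprS prednK ?expf_card //.
exact: ltnW (finNzRing_gt1 F).
Qed.

Lemma is_sq_prim_root (z : F) i :
  (#|F|.-1).-primitive_root z -> is_sq (z ^+ i) = ~~ odd i.
Proof.
move=> zP; apply/is_sqP/idP => [[y Hy] | oi]; last first.
  by exists (z ^+ i./2); rewrite -exprM; congr (_ ^+ _); lia.
have z0 : z != 0.
  exact: prim_root_neq0 zP.
have y0 : y != 0.
  by apply/eqP => y0; move/eqP: Hy; rewrite y0 expr0n expf_eq0 (negbTE z0) andbF.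
have [j yj] := unit_prim_root zP y0; move: Hy; rewrite yj -exprM.
by move/eqP; rewrite (eq_prim_root_expr zP) card_half => /eqP; lia.
Qed.

Lemma is_sqM (x y : F) : x != 0 -> y != 0 -> is_sq (x * y) = (is_sq x == is_sq y).
Proof.
have [z zP] := finField_prim_root F.
move=> /(unit_prim_root zP)[i ->] /(unit_prim_root zP)[j ->].
by rewrite -exprD !is_sq_prim_root // oddD; do 2!case: odd.
Qed.

Lemma is_sq_euler (x : F) : x != 0 -> is_sq x = (x ^+ h == 1).
Proof.
have [z zP] := finField_prim_root F; move=> /(unit_prim_root zP)[i ->].
rewrite is_sq_prim_root // -exprM -(prim_order_dvd zP) card_half -mul2n.
by rewrite dvdn_pmul2r ?card_half_gt0 // dvdn2.
Qed.

Lemma is_sq_sqr (x : F) : is_sq (x ^+ 2).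
Proof. by apply/is_sqP; exists x. Qed.

Lemma is_sqMsqr (x y : F) : y != 0 -> is_sq (x * y ^+ 2) = is_sq x.
Proof.
move=> y0; have [->|x0] := eqVneq x 0; first by rewrite mul0r.
by rewrite is_sqM ?expf_neq0 // is_sq_sqr eqb_id.
Qed.

Lemma qchiM (x y : F) : qchi (x * y) = qchi x * qchi y.
Proof.
rewrite /qchi mulf_eq0; case: eqP => [|/eqP x0] /=; first by rewrite mul0r.
case: eqP => [|/eqP y0] /=; first by rewrite mulr0.
by rewrite is_sqM //; do 2!case: is_sq.
Qed.

Lemma qchi_sqr_neq0 (x : F) : x != 0 -> qchi x * qchi x = 1.
Proof. by rewrite /qchi => /negbTE ->; case: is_sq. Qed.

Lemma qchi_cases (x : F) : [\/ qchi x = 0, qchi x = 1 | qchi x = -1].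
Proof.
by rewrite /qchi; case: eqP; [constructor 1|case: is_sq; [constructor 2|constructor 3]].
Qed.

Lemma qchi1 : qchi (1 : F) = 1.
Proof. by rewrite /qchi oner_eq0 -(expr1n _ 2) is_sq_sqr. Qed.

Lemma qchi0 : qchi (0 : F) = 0.
Proof. by rewrite /qchi eqxx. Qed.

(** Reindexing by a generator of the unit group, which is not a square, changes the sign of the
    sum. *)
Lemma sum_qchi : \sum_(x : F) qchi x = 0.
Proof.
have [z zP] := finField_prim_root F.
have z0 : z != 0.
  exact: prim_root_neq0 zP.
have cz : qchi z = -1.
  by rewrite /qchi (negbTE z0) -[z]expr1 is_sq_prim_root.
have : \sum_(x : F) qchi x = - \sum_(x : F) qchi x.
  rewrite {1}(reindex_inj (mulfI z0)) -sumrN; apply: eq_bigr => x _.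
  by rewrite qchiM cz mulN1r.
lia.
Qed.

Lemma sum_qchi_shift a : \sum_(x : F) qchi (x - a) = 0.
Proof.
rewrite -[RHS]sum_qchi [LHS](reindex_inj (addIr a)) /=; apply: eq_bigr => x _.
by rewrite addrK.
Qed.

(* (x - a)(x - b) is a square times (x - a)/(x - b), a Moebius function of x
   mapping F \ {b} bijectively onto F \ {1}. *)
Lemma sum_qchi2 a b : a != b -> \sum_(x : F) qchi (x - a) * qchi (x - b) = -1.
Proof.
move=> ab; have ba : b - a != 0 by rewrite subr_eq0 eq_sym.
rewrite (bigD1 b) //= subrr qchi0 mulr0 add0r.
have -> : \sum_(x | x != b) qchi (x - a) * qchi (x - b)
   = \sum_(x | x != b) qchi (1 + (b - a) / (x - b)).
  apply: eq_bigr => x xb; have xb0 : x - b != 0 by rewrite subr_eq0.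
  rewrite -[LHS]mulr1 -(qchi_sqr_neq0 (x := (x - b)^-1)) ?invr_eq0 //.
  rewrite -!qchiM; congr qchi; by field.
have := sum_qchi; rewrite (bigD1 1) //= qchi1 => /eqP; rewrite addrC addr_eq0 => /eqP <-.
rewrite [RHS](reindex_onto (fun x => 1 + (b - a) / (x - b)) (fun u => b + (b - a) / (u - 1))).
  apply: eq_bigl => x; rewrite -subr_eq0 -[in RHS]subr_eq0 [1 + _]addrC addrK.
  have [->|xb] := eqVneq x b.
    by rewrite !subrr invr0 mulr0 eqxx.
  have xb0 : x - b != 0 by rewrite subr_eq0.
  rewrite mulf_neq0 ?invr_eq0 //= subr_eq0 xb; apply/esym/eqP.
  by field; rewrite xb0.
move=> u u1; have u10 : u - 1 != 0 by rewrite subr_eq0.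
field; rewrite u10 /=; apply: contra ba => /eqP E0; apply/eqP; rewrite -E0; ring.
Qed.

(* If T(s1, s2) is the sum below, expanding gives T(s1, s2) = q + S - s1 - s2 - s1 s2
   with S = \sum chi((x - a)(x - b)(x - c)), so T(s1, s2) = T(1, 1) + 4 >= 4. *)
Lemma qchi_prescribed (a b c : F) (s1 s2 : int) :
  a != b -> a != c -> b != c ->
  s1 * s1 = 1 -> s2 * s2 = 1 -> (s1 != 1) || (s2 != 1) ->
  exists x, [/\ qchi (x - a) != - s1, qchi (x - b) != - s2
             & qchi (x - c) != - (s1 * s2)].
Proof.
move=> ab ac bc s11 s22 s12.
have [s1E s2E] : (s1 = 1 \/ s1 = -1) /\ (s2 = 1 \/ s2 = -1) by nia.
pose T (s1 s2 : int) := \sum_(x : F) (1 + s1 * qchi (x - a)) *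
   ((1 + s2 * qchi (x - b)) * (1 + s1 * s2 * qchi (x - c))).
have TE r1 r2 : r1 * r1 = 1 -> r2 * r2 = 1 ->
   T r1 r2 = (\sum_(x : F) 1) + (\sum_(x : F) qchi (x - a) * qchi (x - b) * qchi (x - c))
             - r1 - r2 - r1 * r2.
  move=> r11 r22.
  transitivity (\sum_(x : F) (1 + qchi (x - a) * qchi (x - b) * qchi (x - c)
     + r1 * qchi (x - a) + r2 * qchi (x - b) + (r1 * r2) * qchi (x - c)
     + (r1 * r2) * (qchi (x - a) * qchi (x - b)) + r2 * (qchi (x - a) * qchi (x - c))
     + r1 * (qchi (x - b) * qchi (x - c)))).
    apply: eq_bigr => x _; move: (qchi _) (qchi _) (qchi _) => Z Y X.
    transitivity (1 + (r1 * r1) * (r2 * r2) * (X * Y * Z) + r1 * X + r2 * Y + r1 * r2 * Z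
       + r1 * r2 * (X * Y) + (r1 * r1) * r2 * (X * Z) + (r2 * r2) * r1 * (Y * Z)).
      by ring.
    by rewrite r11 r22; ring.
  rewrite !big_split /= -!mulr_sumr !sum_qchi_shift !sum_qchi2 //; ring.
have T0 : 0 <= T 1 1.
  apply: sumr_ge0 => x _.
  by have [] := (qchi_cases (x - a)); have [] := (qchi_cases (x - b));
    have [] := (qchi_cases (x - c)) => -> -> ->.
have Tpos : 0 < T s1 s2.
  have := TE _ _ s11 s22; have := TE 1 1 erefl erefl.
  by case: s1E s12 => ->; case: s2E => -> // _ ; lia.
(* A positive sum has a nonzero term. A factor 1 + s q vanishes when q = -s; the value q = 0 is
   allowed, so x may be one of a, b, c. This is why the conclusion is stated with inequalities. *)
have [x Hx] : exists x, (1 + s1 * qchi (x - a)) *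
   ((1 + s2 * qchi (x - b)) * (1 + s1 * s2 * qchi (x - c))) != 0.
  apply/existsP; apply: contraTT Tpos; rewrite negb_exists => /forallP H.
  by rewrite /T big1 // => x _; apply/eqP; have := H x; rewrite negbK.
exists x; move: Hx; rewrite !mulf_eq0 !negb_or => /andP[H1 /andP[H2 H3]].
have s1212 : s1 * s2 * (s1 * s2) = 1 by rewrite mulrACA s11 s22.
have aux (s q : int) : s * s = 1 -> 1 + s * q != 0 -> q != - s.
  by move=> ss; apply: contraNneq => ->; rewrite mulrN ss subrr.
by split; apply: aux.
Qed.

End QuadraticCharacter.

(* The additive characters [-1/.], [2/.] and [./3] = [-3/.] of the integers prime to 6. *)
Definition e4 (a : int) : 'F_2 := ((a %% 4)%Z == 3)%:R.
Definition e8 (a : int) : 'F_2 := (((a %% 8)%Z == 3) || ((a %% 8)%Z == 5))%:R.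
Definition e3 (a : int) : 'F_2 := ((a %% 3)%Z == 2)%:R.

(** * The supplementary laws: quadratic symbols of -1, 2 and -3 *)

Section Supplements.
Variable F : finFieldType.
Hypothesis oddF : odd #|F|.

Lemma is_sqN1 : is_sq (-1 : F) = ~~ odd #|F|.-1./2.
Proof.
have [z zP] := finField_prim_root F.
by rewrite -(prim_root_half oddF zP) is_sq_prim_root.
Qed.

(* A square root of -3 is 2w + 1 with w a primitive cube root of unity. *)
Lemma is_sqN3 : 3 != 0 :> F -> is_sq (-3 : F) = (3 %| #|F|.-1)%N.
Proof.
move=> F3; have F2 := two_neq0 oddF; have [z zP] := finField_prim_root F.
apply/is_sqP/idP => [[s Hs] | /dvdnP[m Hm]].
  pose w := (s - 1) / 2.
  have w2 : w ^+ 2 + w + 1 = 0.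
    have F4 : 4 != 0 :> F by rewrite (natrM _ 2 2) mulf_neq0.
    have -> : w ^+ 2 + w + 1 = (s ^+ 2 + 3) / 4 by rewrite /w; field; rewrite F2 F4.
    by rewrite -Hs addNr mul0r.
  have w3 : w ^+ 3 = 1.
    apply/eqP; rewrite -subr_eq0; apply/eqP.
    by transitivity ((w - 1) * (w ^+ 2 + w + 1)); [ring | rewrite w2 mulr0].
  have w1 : w != 1.
    by apply: contraNneq F3 => w1; rewrite -w2 w1; apply/eqP; ring.
  have w0 : w != 0 by apply: contra_eq_neq w3 => ->; rewrite expr0n eq_sym oner_eq0.
  have [i wi] := unit_prim_root zP w0; move: w3 w1; rewrite wi -exprM.
  move/eqP; rewrite -(prim_order_dvd zP) -(prim_order_dvd zP) => d3 nd.
  apply: contraNT nd => n3; move: d3; rewrite Gauss_dvdl //.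
  by rewrite coprime_sym prime_coprime.
pose w := z ^+ m.
have w3 : (w - 1) * (w ^+ 2 + w + 1) = 0.
  transitivity (w ^+ 3 - 1); first by ring.
  by rewrite -exprM -Hm (prim_expr_order zP) subrr.
have w1 : w - 1 != 0.
  rewrite subr_eq0 -(prim_order_dvd zP) Hm; apply/negP => /dvdn_leq.
  have := prim_order_gt0 zP; rewrite Hm; lia.
exists (2 * w + 1); move/eqP: w3; rewrite mulf_eq0 (negbTE w1) /= => /eqP w2.
by apply/eqP; rewrite -subr_eq0 -oppr_eq0 -(mulr0 4) -w2; apply/eqP; ring.
Qed.
End Supplements.

Section LegendreSymbol.
Variable p : nat.
Hypotheses (p_pr : prime p) (p_odd : odd p).

Let Fp_card : #|'F_p| = p := card_Fp p_pr.
Let Fp_odd : odd #|'F_p|.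
Proof. by rewrite Fp_card. Qed.

Lemma intrFp_eq0 (m : int) : (m%:~R == 0 :> 'F_p) = (p %| m)%Z.
Proof. by rewrite (dvdz_pcharf (pchar_Fp p_pr)). Qed.

Lemma intrFp_eq (m k : int) : (m%:~R == k%:~R :> 'F_p) = (p %| m - k)%Z.
Proof. by rewrite -subr_eq0 -rmorphB intrFp_eq0. Qed.

Lemma FpP (x : 'F_p) : exists m : int, x = m%:~R.
Proof. by exists (x : nat)%:Z; rewrite -[LHS]natr_Zp. Qed.

Lemma legendre_addE (a : int) : ~~ (p %| a)%Z ->
  legendre_add a p = (~~ is_sq (a%:~R : 'F_p))%:R.
Proof.
move=> pa; rewrite /legendre_add /legendre (negbTE pa) -[[exists x, _]]/(is_sq _).
by case: is_sq.
Qed.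

Lemma legendre_addM (a b : int) : ~~ (p %| a)%Z -> ~~ (p %| b)%Z ->
  legendre_add (a * b) p = legendre_add a p + legendre_add b p.
Proof.
move=> pa pb; have pab : ~~ (p %| a * b)%Z.
  by rewrite -intrFp_eq0 rmorphM mulf_eq0 !intrFp_eq0 negb_or pa.
rewrite !legendre_addE // rmorphM /= is_sqM ?intrFp_eq0 //.
by do 2!case: is_sq; apply/eqP.
Qed.

Lemma dvdz_prime_small (m : nat) : (0 < m < p)%N -> ~~ (p %| m%:Z)%Z.
Proof. by case/andP => m0 mp; rewrite dvdzE /= gtnNdvd. Qed.

Lemma legendre_addN1 : legendre_add (-1) p = e4 p.
Proof.
have p1 : ~~ (p %| -1)%Z by rewrite dvdzE /= dvdn1 -[p == 1%N]negbK neq_ltn prime_gt1 // orbT.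
rewrite legendre_addE // rmorphN1 is_sqN1 // Fp_card negbK /e4.
by congr (_%:R); congr nat_of_bool; move: p_odd; lia.
Qed.

(* With F_(p^2) = F_p(z), z of order 8 exists in F_(p^2) and y := z + z^-1 has square 2;
   2 is a square in F_p iff y^p = y, and z^p + z^-p = y iff p = +-1 mod 8. *)
Lemma legendre_add2 : legendre_add 2 p = e8 p.
Proof.
have p_gt1 := prime_gt1 p_pr.
have p2 : ~~ (p %| 2)%Z by apply: (@dvdz_prime_small 2); move: p_odd; lia.
have x20 : (2%:~R : 'F_p) != 0 by rewrite intrFp_eq0.
rewrite legendre_addE // is_sq_euler // Fp_card.
have [K pK cK] := pPrimePowerField p_pr (isT : 0 < 2)%N.
have [z zP] := finField_prim_root K.
have d8 : (8 %| (p ^ 2).-1)%N.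
  have [m ->] : exists m, p = m.*2.+1 by exists p./2; move: p_odd; lia.
  have [k [->|->]] : exists k, m = k.*2 \/ m = k.*2.+1 by exists m./2; lia.
    by apply/dvdnP; exists (k * (2 * k + 1))%N; nia.
  by apply/dvdnP; exists ((k + 1) * (2 * k + 1))%N; nia.
have [c cE] := dvdnP d8; rewrite cK in zP.
pose w := z ^+ c; have w0 : w != 0 by rewrite expf_neq0 ?(prim_root_neq0 zP).
have w8 : w ^+ 8 = 1 by rewrite -exprM -cE (prim_expr_order zP).
have w4 : w ^+ 4 = -1.
  have : (w ^+ 4 - 1) * (w ^+ 4 + 1) == 0 by rewrite -subr_sqr expr1n -exprM w8 subrr.
  rewrite mulf_eq0 subr_eq0 -exprM -(prim_order_dvd zP) => /orP[|]; last first.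
    by rewrite addr_eq0 => /eqP.
  have := prim_order_gt0 zP; rewrite cE => c0 /dvdn_leq; lia.
pose y := w + w^-1.
have y2 : y ^+ 2 = 2.
  have -> : y ^+ 2 = 2 + (w ^+ 4 + 1) / w ^+ 2 by rewrite /y; field; rewrite w0.
  by rewrite w4 addNr mul0r addr0.
have K2 : (2 : K) != 0.
  by rewrite (dvdz_pcharf pK 2) in p2.
have y0 : y != 0 by apply: contraNneq K2 => y0; rewrite -y2 y0 expr0n.
have yp : y ^+ p = w ^+ p + (w ^+ p)^-1.
  by rewrite -exprVn -!(pFrobenius_autE pK) rmorphD.
have wp : w ^+ p = w ^+ (p %% 8).
  by rewrite {1}(divn_eq p 8) exprD mulnC exprM w8 expr1n mul1r.
have yp' : y ^+ p = (-1) ^+ ((p %% 8 == 3) || (p %% 8 == 5))%N * y.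
  have : (p %% 8 = 1 \/ p %% 8 = 3 \/ p %% 8 = 5 \/ p %% 8 = 7)%N by move: p_odd; lia.
  have wN1 : (-1 : K) != 0 by rewrite oppr_eq0 oner_eq0.
  rewrite yp wp /y; case=> [|[|[|]]] -> /=.
  - by rewrite expr1 expr0 mul1r.
  - transitivity ((w ^+ 4) / w + w / w ^+ 4); first by field.
    by rewrite w4; field; rewrite ?w0 ?wN1.
  - transitivity ((w ^+ 4) * w + w^-1 / w ^+ 4); first by field.
    by rewrite w4; field; rewrite ?w0 ?wN1.
  - transitivity ((w ^+ 4) * (w ^+ 4) / w + w / (w ^+ 4 * w ^+ 4)); first by field.
    by rewrite w4 mulN1r opprK !divr1 div1r expr0 mul1r addrC.
(* K and ['F_p] have the same characteristic, so an equality between images of integers passes from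
   K to ['F_p]; Euler's criterion can then be evaluated in K, where 2 = y^2. *)
have eu (m : int) : 2 ^+ p.-1./2 = m%:~R :> K -> (2%:~R : 'F_p) ^+ p.-1./2 = m%:~R.
  move/eqP; rewrite -subr_eq0 -[2]/(2%:~R) -rmorphXn -rmorphB /= -(dvdz_pcharf pK) => H.
  by apply/eqP; rewrite -subr_eq0 -rmorphXn -rmorphB /= intrFp_eq0.
have hK : 2 ^+ p.-1./2 = (((-1) ^+ ((p %% 8 == 3) || (p %% 8 == 5))%N) : int)%:~R :> K.
  apply: (mulIf y0); rewrite -y2 -exprM -exprSr rmorphXn rmorphN1 -yp'.
  by congr (_ ^+ _); move: p_odd; lia.
rewrite (eu _ hK) rmorphXn rmorphN1 /e8.
have -> : ((p%:Z %% 8)%Z == 3) || ((p%:Z %% 8)%Z == 5) = ((p %% 8 == 3) || (p %% 8 == 5))%N by lia.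
by case: orb; rewrite ?expr0 ?eqxx // expr1 eq_sym -subr_eq0 opprK -[1 + 1]/(2%:~R) (negbTE x20).
Qed.

Lemma legendre_addN3 : p != 3 -> legendre_add (-3) p = e3 p.
Proof.
move=> p3; have p_gt1 := prime_gt1 p_pr.
have p3' : ~~ (p %| 3)%Z by apply: (@dvdz_prime_small 3); move: p_odd p3; lia.
have F3 : 3 != 0 :> 'F_p by rewrite -(intrFp_eq0 3) in p3'.
rewrite legendre_addE; last by rewrite rpredN.
rewrite rmorphN /= is_sqN3 // Fp_card /e3.
have : ~~ (3 %| p)%N by rewrite dvdn_prime2 // eq_sym.
by move=> np; congr (_%:R); congr nat_of_bool; move: np; lia.
Qed.

End LegendreSymbol.

(** * p-adic numbers *)

Lemma dvdz_primeM (p : nat) (a b : int) : prime p ->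
  (p %| a * b)%Z = (p %| a)%Z || (p %| b)%Z.
Proof. by move=> p_pr; rewrite !dvdzE abszM Euclid_dvdM. Qed.

Definition isq (K : fieldType) (x : K) : Prop := exists s, x = s ^+ 2.

Section Padic.
Variables (p : nat) (p_pr : prime p).
Local Notation Zp := (padic_int p_pr).
Local Notation K := (Qp p_pr).
Local Notation pk k := ((p ^ k)%N%:Z).

Lemma padic_intr (m : int) : m%:~R = padic_of_int p_pr m :> Zp.
Proof.
have step a b : padic_of_int p_pr (a + b) = padic_of_int p_pr a + padic_of_int p_pr b.
  by apply: padic_intP => k /=; rewrite modzDm.
have e0 : padic_of_int p_pr 0 = 0 by [].
have e1 : padic_of_int p_pr (Posz 1) = 1 by [].
elim/int_rec: m => [|n IH|n IH]; first by [].
- by rewrite -addn1 PoszD rmorphD /= IH step e1.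
- have N a : padic_of_int p_pr (- a) = - padic_of_int p_pr a.
    by apply/eqP; rewrite -subr_eq0 opprK -step addNr e0.
  by rewrite -addn1 PoszD opprD rmorphD /= IH step (N 1%:Z) e1 rmorphN.
Qed.

Lemma residue_intr (m : int) k : (m%:~R : Zp) k = (m %% pk k)%Z.
Proof. by rewrite padic_intr. Qed.

Lemma residueD (x y : Zp) k : (x + y) k = ((x k + y k) %% pk k)%Z.
Proof. by []. Qed.

Lemma residueM (x y : Zp) k : (x * y) k = ((x k * y k) %% pk k)%Z.
Proof. by []. Qed.

Lemma pk_gt0 k : 0 < pk k.
Proof. by rewrite ltz_nat expn_gt0 prime_gt0. Qed.

Lemma intrZp_eq0 (m : int) : (m%:~R == 0 :> Zp) = (m == 0).
Proof.
apply/eqP/eqP => [|-> //] m0.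
(* The modulus p^(|m|+1) exceeds |m|, so it divides m only if m = 0. *)
have /(congr1 (fun x : Zp => x `|m|.+1%N)) := m0.
rewrite residue_intr /= mod0z => /dvdz_mod0P /dvdzP[c mE].
apply/eqP; rewrite -absz_eq0; apply/eqP.
have lt : (`|m| < p ^ `|m|.+1)%N by rewrite (ltn_trans (ltnSn _)) // ltn_expl ?prime_gt1.
move: (congr1 absz mE); rewrite abszM absz_nat.
by case: `|c|%N => [|c']; [rewrite mul0n | move: lt; nia].
Qed.

Lemma tofrac_intr (m : int) : FracField.tofrac (m%:~R : Zp) = m%:~R :> K.
Proof. exact: rmorph_int. Qed.

Lemma intrQp_eq0 (m : int) : (m%:~R == 0 :> K) = (m == 0).
Proof. by rewrite -tofrac_intr tofrac_eq0 intrZp_eq0. Qed.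

Lemma padic_sqrt (a : int) (f : nat -> int) :
  (forall k, (pk k %| f k.+1 - f k)%Z) -> (forall k, (pk k %| f k ^+ 2 - a)%Z) ->
  isq (a%:~R : K).
Proof.
move=> fS fa; have fS' k : (f k.+1 %% pk k)%Z = (f k %% pk k)%Z.
  by apply/eqP; rewrite eqz_mod_dvd.
exists (FracField.tofrac (PadicInt p_pr (trunc_coherent fS'))).
rewrite -tofrac_intr -rmorphXn; congr FracField.tofrac.
apply: padic_intP => k; rewrite residue_intr expr2 residueM /= modzMml modzMmr.
by apply/eqP; rewrite eqz_mod_dvd -expr2 -opprB rpredN.
Qed.

(* Newton's iteration r - (r^2 - a) c with the constant slope c = 1/(2 r0) mod p. *)
Lemma padic_hensel (a : int) : odd p -> ~~ (p %| a)%Z ->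
  is_sq (a%:~R : 'F_p) -> isq (a%:~R : K).
Proof.
move=> p_odd pa /is_sqP[y]; have [r ->] := FpP y => /eqP.
rewrite -rmorphXn intrFp_eq // => ar.
have pr : ~~ (p %| 2 * r)%Z.
  rewrite dvdz_primeM // negb_or; apply/andP; split.
    by apply: (@dvdz_prime_small p 2); have := prime_gt1 p_pr; move: p_odd; lia.
  by apply: contra pa => pr; rewrite -[a](subrK (r ^+ 2)) rpredD // expr2 dvdz_mulr.
have [c cE] : exists c, (p %| 1 - 2 * r * c)%Z.
  have : coprimez p (2 * r) by rewrite coprimezE prime_coprime // -dvdzE.
  move/coprimezP => [[u v] /= uv]; exists v; apply/dvdzP; exists u.
  by rewrite -[X in X - _]uv; ring.
pose g x := x - (x ^+ 2 - a) * c.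
have gP k : (p %| iter k g r - r)%Z /\ (pk k.+1 %| iter k g r ^+ 2 - a)%Z.
  elim: k => [|k [IH1 IH2]] /=.
    by rewrite subrr dvdz0 expn1 -opprB rpredN.
  set x := iter k g r in IH1 IH2 *.
  have px : (p %| x ^+ 2 - a)%Z.
    by apply: dvdz_trans IH2; rewrite expnS PoszM dvdz_mulr.
  split.
    by rewrite /g -addrA [- _ - _]addrC addrA rpredB // dvdz_mulr.
  (* The new error is the old one times a factor divisible by p, because 1 - 2rc, x - r and the old
     error all are. *)
  have -> : g x ^+ 2 - a = (x ^+ 2 - a) * ((1 - 2 * r * c) - 2 * c * (x - r)
             + (x ^+ 2 - a) * c ^+ 2) by rewrite /g; ring.
  rewrite expnSr PoszM; apply: dvdz_mul => //.
  by apply: rpredD; [apply: rpredB => //; apply: dvdz_mull | apply: dvdz_mulr].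
apply: (@padic_sqrt _ (fun k => iter k g r)) => k.
  have [_ H] := gP k; rewrite /= /g [_ - _ - _]addrAC subrr add0r rpredN dvdz_mulr //.
  by apply: dvdz_trans H; rewrite expnS PoszM dvdz_mull.
by have [_ H] := gP k; apply: dvdz_trans H; rewrite expnS PoszM dvdz_mull.
Qed.

End Padic.

(** Newton's correction (a - x^2)/(2x) is replaced by (a - x^2)/2, since x stays odd and 1/x = 1 mod
    2. The error gains one factor 2 per step, starting from 8; this initial 8 keeps the quadratic
    term of the correction harmless. *)
Lemma padic2_hensel (p_pr : prime 2) (a : int) : (8 %| a - 1)%Z -> isq (a%:~R : Qp p_pr).
Proof.
move=> a1.
pose g x := x + ((a - x ^+ 2) %/ 2)%Z.
have gP k : (2 %| iter k g 1 - 1)%Z /\ ((2 ^ (k + 3))%N%:Z %| a - iter k g 1 ^+ 2)%Z.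
  elim: k => [|k [IH1 IH2]] /=; first by rewrite subrr dvdz0 expr1n.
  set x := iter k g 1 in IH1 IH2 *.
  have [m mE] := dvdzP IH2; have [n nE] := dvdzP IH1.
  have xE : x = n * 2 + 1 by rewrite -nE subrK.
  have gE : g x = x + m * (2 ^ k)%N%:Z * 4.
    rewrite /g mE (_ : _ * _ = m * (2 ^ k)%N%:Z * 4 * 2); first by rewrite mulzK.
    by rewrite expnD PoszM; ring.
  split.
    apply/dvdzP; exists (n + m * (2 ^ k)%N%:Z * 2); rewrite gE xE; ring.
  apply/dvdzP; exists (- m * n - m ^+ 2 * (2 ^ k)%N%:Z).
  rewrite gE; transitivity ((a - x ^+ 2) - x * m * (2 ^ k)%N%:Z * 8 - m ^+ 2 * (2 ^ k)%N%:Z ^+ 2 * 16);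
    first by ring.
  by rewrite mE xE !(expnD, expnS) !PoszM; ring.
apply: (@padic_sqrt _ _ _ (fun k => iter k g 1)) => k; have [_ H] := gP k.
  rewrite /= /g [_ + _ - _]addrAC subrr add0r.
  have [m mE] := dvdzP H; rewrite mE; apply/dvdzP; exists (m * 4).
  rewrite (_ : m * _ = m * (2 ^ k)%N%:Z * 4 * 2); first by rewrite mulzK //; ring.
  by rewrite expnD PoszM; ring.
by rewrite -opprB rpredN; apply: dvdz_trans H; rewrite expnD PoszM dvdz_mulr.
Qed.

(** * Solubility of the coverings *)

Lemma frac_fractionP (D : idomainType) (x : {fraction D}) :
  exists n d : D, d != 0 /\ x = FracField.tofrac n / FracField.tofrac d.
Proof.
elim/quotW: x => r; exists \n_r, \d_r; have d0 := denom_ratioP r; split=> //.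
apply: (canRL (mulfK _)); first by rewrite tofrac_eq0.
unlock FracField.tofrac; rewrite -[LHS]FracField.pi_mul; apply/eqP.
rewrite FracField.equivf_def /FracField.mulf !numden_Ratio ?mulr1 ?oner_neq0 //.
by rewrite mulrC.
Qed.

(** Both equations are homogeneous of degree 2, so the coordinates may be multiplied by the product
    of their four denominators. *)
Lemma frac_clear (D : idomainType) (B1 B2 B3 N1 N2 : int) :
  (exists z0 z1 z2 z3 : {fraction D}, [/\ [|| z0 != 0, z1 != 0, z2 != 0 | z3 != 0],
     B1%:~R * z1 ^+ 2 - B2%:~R * z2 ^+ 2 = N1%:~R * z0 ^+ 2
   & B1%:~R * z1 ^+ 2 - B3%:~R * z3 ^+ 2 = N2%:~R * z0 ^+ 2]) ->
  exists x0 x1 x2 x3 : D, [/\ [|| x0 != 0, x1 != 0, x2 != 0 | x3 != 0],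
     B1%:~R * x1 ^+ 2 - B2%:~R * x2 ^+ 2 - N1%:~R * x0 ^+ 2 = 0
   & B1%:~R * x1 ^+ 2 - B3%:~R * x3 ^+ 2 - N2%:~R * x0 ^+ 2 = 0].
Proof.
move=> [z0 [z1 [z2 [z3 [nz E1 E2]]]]].
have [n0 [d0 [d00 z0E]]] := frac_fractionP z0.
have [n1 [d1 [d10 z1E]]] := frac_fractionP z1.
have [n2 [d2 [d20 z2E]]] := frac_fractionP z2.
have [n3 [d3 [d30 z3E]]] := frac_fractionP z3.
have F0 (x : D) : x != 0 -> (@FracField.tofrac D) x != 0 by rewrite tofrac_eq0.
pose x0 := n0 * (d1 * d2 * d3); pose x1 := n1 * (d0 * d2 * d3).
pose x2 := n2 * (d0 * d1 * d3); pose x3 := n3 * (d0 * d1 * d2).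
pose Q := (@FracField.tofrac D) (d0 * d1 * d2 * d3).
have Q0 : Q != 0 by rewrite F0 // !mulf_neq0.
have tfM (n d a b : D) : d != 0 -> b = d * a ->
    @FracField.tofrac D (n * a) = @FracField.tofrac D n / @FracField.tofrac D d * @FracField.tofrac D b.
  move=> d0' ->; rewrite !tofracM mulrA; congr (_ * _).
  by rewrite mulfVK // F0.
have e0 : @FracField.tofrac D x0 = z0 * Q by rewrite z0E; apply: tfM => //; ring.
have e1 : @FracField.tofrac D x1 = z1 * Q by rewrite z1E; apply: tfM => //; ring.
have e2 : @FracField.tofrac D x2 = z2 * Q by rewrite z2E; apply: tfM => //; ring.
have e3 : @FracField.tofrac D x3 = z3 * Q by rewrite z3E; apply: tfM => //; ring.
have scale (L : fieldType) (a b c x y z q : L) : a * x ^+ 2 - b * y ^+ 2 = c * z ^+ 2 ->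
    a * (x * q) ^+ 2 - b * (y * q) ^+ 2 - c * (z * q) ^+ 2 = 0.
  by move=> E; transitivity ((a * x ^+ 2 - b * y ^+ 2 - c * z ^+ 2) * q ^+ 2);
    [ring | rewrite E subrr mul0r].
clearbody x0 x1 x2 x3 Q.
have Finj : injective (@FracField.tofrac D) by move=> a b /eqP; rewrite tofrac_eq => /eqP.
have {E1} E1 : B1%:~R * x1 ^+ 2 - B2%:~R * x2 ^+ 2 - N1%:~R * x0 ^+ 2 = 0 :> D.
  apply: Finj; rewrite !(rmorphB, rmorphXn, rmorphM) /= !rmorph_int e0 e1 e2 rmorph0.
  exact: scale E1.
have {E2} E2 : B1%:~R * x1 ^+ 2 - B3%:~R * x3 ^+ 2 - N2%:~R * x0 ^+ 2 = 0 :> D.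
  apply: Finj; rewrite !(rmorphB, rmorphXn, rmorphM) /= !rmorph_int e0 e1 e3 rmorph0.
  exact: scale E2.
have {}nz : [|| x0 != 0, x1 != 0, x2 != 0 | x3 != 0].
  have H (x : D) z : (@FracField.tofrac D) x = z * Q -> (z != 0) = (x != 0).
    by move=> e; rewrite -(tofrac_eq0 x) e mulf_eq0 (negbTE Q0) orbF.
  by rewrite -(H _ _ e0) -(H _ _ e1) -(H _ _ e2) -(H _ _ e3).
by exists x0, x1, x2, x3.
Qed.

Section Solvability.
Variable K : fieldType.

(* The 2-covering attached to (b1, b2) for the roots 0, nu, - 3 nu. *)
Definition solK (b1 b2 nu : K) : Prop :=
  exists z0 z1 z2 z3 : K,
    [/\ [|| z0 != 0, z1 != 0, z2 != 0 | z3 != 0],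
        b1 * z1 ^+ 2 - b2 * z2 ^+ 2 = nu * z0 ^+ 2
      & b1 * z1 ^+ 2 - b1 * b2 * z3 ^+ 2 = - 3 * nu * z0 ^+ 2].

Definition sqeq (x y : K) : Prop := exists2 c, c != 0 & x = y * c ^+ 2.

Lemma sqeq_refl x : sqeq x x.
Proof. by exists 1; rewrite ?oner_neq0 // expr1n mulr1. Qed.

Lemma sqeq_sym x y : sqeq x y -> sqeq y x.
Proof.
by case=> c c0 ->; exists c^-1; rewrite ?invr_eq0 // exprVn mulfK // expf_neq0.
Qed.

Lemma sqeq_trans x y z : sqeq x y -> sqeq y z -> sqeq x z.
Proof.
move=> [c c0 ->] [d d0 ->]; exists (d * c); first by rewrite mulf_neq0.
by ring.
Qed.

Lemma sqeqM x y z t : sqeq x y -> sqeq z t -> sqeq (x * z) (y * t).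
Proof.
move=> [c c0 ->] [d d0 ->]; exists (c * d); first by rewrite mulf_neq0.
by ring.
Qed.

Lemma sqeq_isq (x y : K) : x != 0 -> y != 0 -> isq (x * y) -> sqeq x y.
Proof.
move=> x0 y0 [s xy]; exists (s / y).
  by rewrite mulf_neq0 ?invr_eq0 //; apply: contra_eq_neq xy => ->;
     rewrite expr0n mulf_neq0.
by rewrite expr_div_n -xy; field.
Qed.

Lemma solK_sqeq b1 b2 nu b1' b2' nu' :
  sqeq b1 b1' -> sqeq b2 b2' -> sqeq nu nu' -> solK b1 b2 nu -> solK b1' b2' nu'.
Proof.
move=> [c1 c10 ->] [c2 c20 ->] [c0 c00 ->] [z0 [z1 [z2 [z3 [nz E1 E2]]]]].
exists (z0 * c0), (z1 * c1), (z2 * c2), (z3 * (c1 * c2)).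
rewrite !mulf_eq0 (negbTE c10) (negbTE c20) (negbTE c00) !orbF; split=> //.
  transitivity (b1' * c1 ^+ 2 * z1 ^+ 2 - b2' * c2 ^+ 2 * z2 ^+ 2); first by ring.
  by rewrite E1; ring.
transitivity (b1' * c1 ^+ 2 * z1 ^+ 2 - b1' * c1 ^+ 2 * (b2' * c2 ^+ 2) * z3 ^+ 2); first by ring.
by rewrite E2; ring.
Qed.

Lemma isqM (x y : K) : isq x -> isq y -> isq (x * y).
Proof. by move=> [s ->] [t ->]; exists (s * t); rewrite exprMn. Qed.

Lemma isq_sqr (x : K) : isq (x ^+ 2).
Proof. by exists x. Qed.

Lemma isq0 : isq (0 : K).
Proof. by exists 0; rewrite expr0n. Qed.

(* An affine point with abscissa X, or (below) the point at infinity, lifts to the covering. *)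
Lemma solK_affine b1 b2 nu X : b1 != 0 -> b2 != 0 ->
  isq (b1 * X) -> isq (b2 * (X - nu)) -> isq (b1 * b2 * (X + 3 * nu)) -> solK b1 b2 nu.
Proof.
move=> b10 b20 [s1 E1] [s2 E2] [s3 E3].
(* The coordinates are those of the point over X: b1 (z1/z0)^2 = s1^2/b1 = X. *)
exists (b1 * b2), (s1 * b2), (s2 * b1), s3; rewrite mulf_neq0 //.
by rewrite !exprMn -E1 -E2 -E3; split=> //; ring.
Qed.

Lemma solK_infty b1 b2 nu : b1 != 0 -> isq b1 -> isq b2 -> solK b1 b2 nu.
Proof.
move=> b10 [s1 E1] [s2 E2]; exists 0, s2, s1, 1.
rewrite oner_neq0 !orbT expr0n expr1n !mulr0 !mulr1 E1 E2; split=> //; ring.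
Qed.

End Solvability.

(** * Primitive integral approximations of p-adic points *)

Section PadicNecessity.
Variables (p : nat) (p_pr : prime p).
Local Notation Zp := (padic_int p_pr).
Local Notation K := (Qp p_pr).
Local Notation pk k := ((p ^ k)%N%:Z).

Lemma residue_dvd (x : Zp) i j : (pk i %| x (i + j)%N)%Z = (x i == 0).
Proof. by rewrite -(residue_modD x i j); apply/dvdz_mod0P/eqP. Qed.

(** A nonzero vector over Z_p is divided by the largest power of p that divides all its coordinates.
    The division is done on integers, the residues of the coordinates at one sufficiently high
    level. *)
Lemma padic_primitive (B1 B2 B3 N1 N2 : int) :
  (exists z0 z1 z2 z3 : K, [/\ [|| z0 != 0, z1 != 0, z2 != 0 | z3 != 0],
     B1%:~R * z1 ^+ 2 - B2%:~R * z2 ^+ 2 = N1%:~R * z0 ^+ 2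
   & B1%:~R * z1 ^+ 2 - B3%:~R * z3 ^+ 2 = N2%:~R * z0 ^+ 2]) ->
  forall k, exists w0 w1 w2 w3 : int,
    [/\ ~~ [&& p %| w0, p %| w1, p %| w2 & p %| w3]%Z,
        (pk k %| B1 * w1 ^+ 2 - B2 * w2 ^+ 2 - N1 * w0 ^+ 2)%Z
      & (pk k %| B1 * w1 ^+ 2 - B3 * w3 ^+ 2 - N2 * w0 ^+ 2)%Z].
Proof.
move=> /frac_clear[x0 [x1 [x2 [x3 [nz E1 E2]]]]] k.
pose P v := [|| x0 v != 0, x1 v != 0, x2 v != 0 | x3 v != 0].
have exP : exists v, P v.
  by case/or4P: nz => /padic_neq0P[v xv]; exists v; rewrite /P xv ?orbT.
(* With v minimal, all coordinates are divisible by p^(v-1) and one of them is not divisible by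
   p^v. *)
case: (ex_minnP exP) => v Pv vmin.
have v0 : (0 < v)%N.
  case: v Pv {vmin} => // ; rewrite /P.
  by have z (x : Zp) : x 0 = 0 by [rewrite -(residue_mod x) expn0 modz1]; rewrite !z.
have zero (x : Zp) : x \in [:: x0; x1; x2; x3] -> x v.-1 = 0.
  rewrite !inE => Hx; apply/eqP; apply: contraT => xv; have := vmin v.-1.
  have -> : P v.-1.
    by rewrite /P; case/or4P: Hx => /eqP <-; rewrite xv ?orbT.
  by case: (v) v0 => //= u _; rewrite ltnn => /(_ isT).
(* Dividing quadratic equations by p^(2(v-1)) must leave the precision p^k; the last summand v makes
   room for the congruences modulo p^v read off at level m. *)
pose m := (k + v.-1 * 2 + v)%N.
have div (x : Zp) : x \in [:: x0; x1; x2; x3] -> exists w, x m = w * pk v.-1.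
  move=> Hx; apply/dvdzP; rewrite (_ : m = v.-1 + (k + v.-1 + v))%N; last by rewrite /m; lia.
  by rewrite residue_dvd zero.
have [w0 W0] := div x0 (mem_head _ _).
have [w1 W1] := div x1 ltac:(by rewrite !inE eqxx ?orbT).
have [w2 W2] := div x2 ltac:(by rewrite !inE eqxx ?orbT).
have [w3 W3] := div x3 ltac:(by rewrite !inE eqxx ?orbT).
exists w0, w1, w2, w3.
have prim (x : Zp) w : x m = w * pk v.-1 -> (p %| w)%Z -> x v = 0.
  move=> xE pw; apply/eqP; rewrite -(residue_dvd x v (k + v.-1 * 2)).
  have -> : pk v = p%:Z * pk v.-1 by rewrite -PoszM -expnS prednK.
  by rewrite addnC -/m xE dvdz_mul.
have red (B : int) (x : Zp) : (pk m %| (B%:~R * x ^+ 2 : Zp) m - B * x m ^+ 2)%Z.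
  rewrite residueM residue_intr expr2 residueM -eqz_mod_dvd modz_mod modzMml modzMmr.
  by rewrite -?expr2.
have redD (x y : Zp) : (pk m %| (x - y : Zp) m - (x m - y m))%Z.
  by rewrite residueD -eqz_mod_dvd modz_mod -modzDmr /= modz_mod modzDmr.
have cong_trans (M a b c d X Y Z : int) : (M %| 0 - (a - d))%Z -> (M %| a - (b - c))%Z ->
    (M %| b - X)%Z -> (M %| c - Y)%Z -> (M %| d - Z)%Z -> (M %| X - Y - Z)%Z.
  move=> /dvdzP[q0 h0] /dvdzP[q1 h1] /dvdzP[q2 h2] /dvdzP[q3 h3] /dvdzP[q4 h4].
  by apply/dvdzP; exists (- q0 - q1 - q2 + q3 + q4); rewrite !mulrDl !mulNr; lia.
have fin (B C N : int) (x y z : Zp) (wx wy wz : int) :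
    B%:~R * x ^+ 2 - C%:~R * y ^+ 2 - N%:~R * z ^+ 2 = 0 :> Zp ->
    x m = wx * pk v.-1 -> y m = wy * pk v.-1 -> z m = wz * pk v.-1 ->
    (pk k %| B * wx ^+ 2 - C * wy ^+ 2 - N * wz ^+ 2)%Z.
  move=> E xE yE zE.
  have : (pk m %| B * x m ^+ 2 - C * y m ^+ 2 - N * z m ^+ 2)%Z.
    have h0 := redD (B%:~R * x ^+ 2 - C%:~R * y ^+ 2) (N%:~R * z ^+ 2).
    have h1 := redD (B%:~R * x ^+ 2) (C%:~R * y ^+ 2).
    have h2 := red B x; have h3 := red C y; have h4 := red N z.
    have r0 : (0 : Zp) m = 0 by exact: mod0z.
    rewrite E r0 in h0.
    exact: cong_trans h0 h1 h2 h3 h4.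
  rewrite xE yE zE [X in (_ %| X)%Z](_ : _ = (B * wx ^+ 2 - C * wy ^+ 2 - N * wz ^+ 2)
      * pk (v.-1 * 2)); last by rewrite muln2 -addnn expnD PoszM; ring.
  rewrite /m (_ : k + _ + v = v + k + v.-1 * 2)%N; last by lia.
  rewrite expnD PoszM dvdz_mul2r; last by rewrite gt_eqF ?pk_gt0.
  by apply: dvdz_trans; rewrite expnD PoszM dvdz_mull.
split; [|exact: fin E1 W1 W2 W0|exact: fin E2 W1 W3 W0].
apply/negP => /and4P[/(prim _ _ W0) H0 /(prim _ _ W1) H1 /(prim _ _ W2) H2 /(prim _ _ W3) H3].
by move: Pv; rewrite /P H0 H1 H2 H3.
Qed.
End PadicNecessity.

(** * Local conditions at odd primes *)

(** Plays the part of a linear-combination step: the goal x = y follows from a known equation a = b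
    once [ring] has verified x - y = a - b. *)
Lemma lincomb (R : zmodType) (x y a b : R) : a = b -> x - y = a - b -> x = y.
Proof. by move=> -> /eqP; rewrite subrr subr_eq0 => /eqP. Qed.

Lemma PoszXn (m k : nat) : (m ^ k)%N%:Z = m%:Z ^+ k.
Proof. by elim: k => // k IH; rewrite expnS PoszM IH exprS. Qed.

Section OddPrime.
Variables (p : nat) (p_pr : prime p).
Hypothesis p_odd : odd p.
Local Notation K := (Qp p_pr).

Let p_neq0 : p%:Z != 0.
Proof. by have := prime_gt0 p_pr; lia. Qed.

Let Fp_odd : odd #|'F_p|.
Proof. by rewrite card_Fp. Qed.

Lemma dvd_of_sq (a x m : int) : ~~ (p %| a)%Z -> a * x ^+ 2 = p%:Z * m -> (p %| x)%Z.
Proof.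
move=> pa E; have : (p %| a * x ^+ 2)%Z by rewrite E dvdz_mulr.
by rewrite dvdz_primeM // (negbTE pa) expr2 dvdz_primeM // orbb.
Qed.

(** Modulo p the number y is automatically a unit, and a b is the square of a x / y. *)
Lemma sq_of_cong (a b x y m : int) : ~~ (p %| a)%Z -> ~~ (p %| x)%Z ->
  a * x ^+ 2 = b * y ^+ 2 + p%:Z * m -> is_sq ((a * b)%:~R : 'F_p).
Proof.
move=> pa px E; set f := fun u : int => u%:~R : 'F_p.
have fp : f p = 0 by apply/eqP; rewrite intrFp_eq0.
have fa : f a != 0 by rewrite intrFp_eq0.
have fx : f x != 0 by rewrite intrFp_eq0.
have {}E : f a * f x ^+ 2 = f b * f y ^+ 2.
  have := congr1 f E; rewrite /f !(rmorphXn, rmorphD, rmorphM) /= => ->.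
  by rewrite -/(f p) fp mul0r addr0.
have fy : f y != 0.
  apply: contraTneq (mulf_neq0 fa (expf_neq0 2 fx)) => y0.
  by rewrite E y0 expr0n mulr0 eqxx.
apply/is_sqP; exists (f a * f x / f y); rewrite rmorphM /= -/(f a) -/(f b).
by rewrite expr_div_n exprMn [f a ^+ 2]expr2 -[f a * f a * _]mulrA E mulrA mulfK // expf_neq0.
Qed.

Lemma solK_primitive (b1 b2 n : int) :
  solK (b1%:~R : K) b2%:~R n%:~R ->
  forall k, exists w0 w1 w2 w3 c d : int,
    [/\ ~~ [&& p %| w0, p %| w1, p %| w2 & p %| w3]%Z,
        b1 * w1 ^+ 2 - b2 * w2 ^+ 2 - n * w0 ^+ 2 = c * p%:Z ^+ k
      & b1 * w1 ^+ 2 - b1 * b2 * w3 ^+ 2 + 3 * n * w0 ^+ 2 = d * p%:Z ^+ k].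
Proof.
move=> [z0 [z1 [z2 [z3 [nz E1 E2]]]]] k.
have [|w0 [w1 [w2 [w3 [nw /dvdzP[c D1] /dvdzP[d D2]]]]]] :=
    @padic_primitive p p_pr b1 b2 (b1 * b2) n (- 3 * n) _ k.
  by exists z0, z1, z2, z3; split=> //; rewrite !rmorphM.
exists w0, w1, w2, w3, c, d; rewrite -PoszXn; split=> //.
by rewrite -D2; ring.
Qed.

Lemma isq_unit (u : int) : ~~ (p %| u)%Z -> is_sq (u%:~R : 'F_p) -> isq (u%:~R : K).
Proof. exact: padic_hensel. Qed.

Lemma isq_unitM (u : int) : ~~ (p %| u)%Z -> is_sq (u%:~R : 'F_p) ->
  isq ((p%:Z ^+ 2 * u)%:~R : K).
Proof. by move=> pu su; rewrite rmorphM rmorphXn; apply: isqM; [exact: isq_sqr|exact: isq_unit]. Qed.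

Lemma is_sqMl (a b : int) : ~~ (p %| b)%Z ->
  is_sq ((a * b ^+ 2)%:~R : 'F_p) = is_sq (a%:~R : 'F_p).
Proof. by move=> pb; rewrite rmorphM rmorphXn /= is_sqMsqr // intrFp_eq0. Qed.

Lemma solK_affine_int (b1 b2 n X : int) : b1 != 0 -> b2 != 0 ->
  isq ((b1 * X)%:~R : K) -> isq ((b2 * (X - n))%:~R : K) ->
  isq ((b1 * b2 * (X + 3 * n))%:~R : K) -> solK (b1%:~R : K) b2%:~R n%:~R.
Proof.
move=> b10 b20; rewrite !(rmorphM, rmorphB, rmorphD) /=.
by apply: solK_affine; rewrite intrQp_eq0.
Qed.

Section Coprime6.
Hypothesis p_neq3 : p != 3.

Let p3 : ~~ (p %| 3)%Z.
Proof. by rewrite dvdzE /= dvdn_prime2. Qed.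
Let p4 : ~~ (p %| 4)%Z.
Proof.
rewrite -[4%Z]/(2%:Z * 2%:Z) dvdz_primeM // orbb dvdzE /= dvdn_prime2 //.
by apply: contraL p_odd => /eqP ->.
Qed.

(** * Primes not dividing 6n *)

Section Good.
Variable n : int.
Hypothesis pn : ~~ (p %| n)%Z.

(** The differences n, 3n, 4n of the roots are units. Each of the three parity patterns other than
    (even, even) isolates one of them in front of w0^2, so p divides w0, and then the remaining
    coordinates one by one, against primitivity. Precision p^3 is enough, since the equations are
    divided by p at most twice before the last reduction. *)
Lemma good_even_val (u1 u2 : int) (e1 e2 : bool) :
  ~~ (p %| u1)%Z -> ~~ (p %| u2)%Z ->
  solK ((p%:Z ^+ e1 * u1)%:~R : K) (p%:Z ^+ e2 * u2)%:~R n%:~R ->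
  e1 = false /\ e2 = false.
Proof.
move=> pu1 pu2 /solK_primitive /(_ 3)[w0 [w1 [w2 [w3 [c [d [nw E1 E2]]]]]]].
have p3n : ~~ (p %| 3 * n)%Z by rewrite dvdz_primeM // negb_or p3.
have p4n : ~~ (p %| 4 * n)%Z by rewrite dvdz_primeM // negb_or p4.
have pu12 : ~~ (p %| u1 * u2)%Z by rewrite dvdz_primeM // negb_or pu1.
move: e1 e2 E1 E2 => [] [] //; rewrite ?expr1 ?expr0 => E1 E2; exfalso; case/negP: nw.
- have /dvdzP[x0 W0] : (p %| w0)%Z.
    apply: (dvd_of_sq (m := u1 * w1 ^+ 2 - u2 * w2 ^+ 2 - c * p%:Z ^+ 2) pn).
    by apply: (lincomb (esym E1)); ring.
  have /dvdzP[x1 W1] : (p %| w1)%Z.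
    apply: (dvd_of_sq (m := u1 * u2 * w3 ^+ 2 - 3 * n * x0 ^+ 2 + d * p%:Z) pu1).
    by apply: (mulfI p_neq0); apply: (lincomb E2); rewrite W0; ring.
  have /dvdzP[x2 W2] : (p %| w2)%Z.
    apply: (dvd_of_sq (m := u1 * x1 ^+ 2 * p%:Z - n * x0 ^+ 2 - c * p%:Z) pu2).
    by apply: (mulfI p_neq0); apply: (lincomb (esym E1)); rewrite W0 W1; ring.
  have /dvdzP[y0 X0] : (p %| x0)%Z.
    apply: (dvd_of_sq (m := u1 * x1 ^+ 2 - u2 * x2 ^+ 2 - c) pn).
    by do 2![apply: (mulfI p_neq0)]; apply: (lincomb (esym E1)); rewrite W0 W1 W2; ring.
  have -> : (p %| w3)%Z.
    apply: (dvd_of_sq (m := u1 * x1 ^+ 2 + 3 * n * y0 ^+ 2 * p%:Z - d) pu12).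
    by do 2![apply: (mulfI p_neq0)]; apply: (lincomb (esym E2)); rewrite W0 W1 X0; ring.
  by rewrite W0 W1 W2 !dvdz_mull.
- have /dvdzP[x0 W0] : (p %| w0)%Z.
    apply: (dvd_of_sq (m := d * p%:Z ^+ 2 - u1 * w1 ^+ 2 + u1 * u2 * w3 ^+ 2) p3n).
    by apply: (lincomb E2); ring.
  have /dvdzP[x2 W2] : (p %| w2)%Z.
    apply: (dvd_of_sq (m := u1 * w1 ^+ 2 - n * x0 ^+ 2 * p%:Z - c * p%:Z ^+ 2) pu2).
    by apply: (lincomb (esym E1)); rewrite W0; ring.
  have /dvdzP[x1 W1] : (p %| w1)%Z.
    apply: (dvd_of_sq (m := u2 * x2 ^+ 2 + n * x0 ^+ 2 + c * p%:Z) pu1).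
    by apply: (mulfI p_neq0); apply: (lincomb E1); rewrite W0 W2; ring.
  have -> : (p %| w3)%Z.
    apply: (dvd_of_sq (m := u1 * x1 ^+ 2 * p%:Z + 3 * n * x0 ^+ 2 - d * p%:Z) pu12).
    by apply: (mulfI p_neq0); apply: (lincomb (esym E2)); rewrite W0 W1; ring.
  by rewrite W0 W1 W2 !dvdz_mull.
(* Valuation of b1 even, of b2 odd: subtracting the equations removes u1 w1^2 and leaves 4n w0^2. *)
- have /dvdzP[x0 W0] : (p %| w0)%Z.
    apply: (dvd_of_sq (m := (d - c) * p%:Z ^+ 2 - u2 * w2 ^+ 2 + u1 * u2 * w3 ^+ 2) p4n).
    by apply: (lincomb (congr2 (fun x y => x - y) E2 E1)); rewrite /=; ring.
  have /dvdzP[x1 W1] : (p %| w1)%Z.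
    apply: (dvd_of_sq (m := u2 * w2 ^+ 2 + n * x0 ^+ 2 * p%:Z + c * p%:Z ^+ 2) pu1).
    by apply: (lincomb E1); rewrite W0; ring.
  have /dvdzP[x2 W2] : (p %| w2)%Z.
    apply: (dvd_of_sq (m := u1 * x1 ^+ 2 - n * x0 ^+ 2 - c * p%:Z) pu2).
    by apply: (mulfI p_neq0); apply: (lincomb (esym E1)); rewrite W0 W1; ring.
  have -> : (p %| w3)%Z.
    apply: (dvd_of_sq (m := u1 * x1 ^+ 2 + 3 * n * x0 ^+ 2 - d * p%:Z) pu12).
    by apply: (mulfI p_neq0); apply: (lincomb (esym E2)); rewrite W0 W1; ring.
  by rewrite W0 W1 W2 !dvdz_mull.
Qed.

(** If u1 and u2 are squares modulo p, the point at infinity lifts. Otherwise [qchi_prescribed],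
    applied to the roots 0, n, -3n and the characters of u1 and u2, gives an abscissa m modulo p at
    which none of the three products is a nonsquare. *)
Lemma good_soluble (u1 u2 : int) : ~~ (p %| u1)%Z -> ~~ (p %| u2)%Z ->
  solK (u1%:~R : K) u2%:~R n%:~R.
Proof.
move=> pu1 pu2; set f := fun u : int => u%:~R : 'F_p.
have fE (u : int) : (f u == 0) = (p %| u)%Z by rewrite intrFp_eq0.
have nz (u : int) : ~~ (p %| u)%Z -> u != 0 by apply: contraNneq => ->; rewrite dvdz0.
have [s1|s1] := boolP (is_sq (f u1) && is_sq (f u2)).
  case/andP: s1 => s1 s2; apply: solK_infty; first by rewrite intrQp_eq0 nz.
    exact: isq_unit.
  exact: isq_unit.
have q1 : qchi (f u1) * qchi (f u1) = 1 by apply: qchi_sqr_neq0 => //; rewrite fE.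
have q2 : qchi (f u2) * qchi (f u2) = 1 by apply: qchi_sqr_neq0 => //; rewrite fE.
have s12 : (qchi (f u1) != 1) || (qchi (f u2) != 1).
  by move: s1; rewrite negb_and /qchi !fE (negbTE pu1) (negbTE pu2); do 2!case: is_sq.
have [] := @qchi_prescribed _ Fp_odd 0 (f n) (f (- 3 * n)) _ _ _ _ _ q1 q2 s12.
- by rewrite eq_sym fE.
- by rewrite eq_sym fE mulNr rpredN dvdz_primeM // negb_or p3.
- rewrite -subr_eq0 -rmorphB /= fE (_ : _ - _ = 4 * n); last by ring.
  by rewrite dvdz_primeM // negb_or p4.
move=> x; have [m ->] := FpP x => [[H1 H2 H3]].
have {H1}H1 : qchi (f (u1 * m)) != -1.
  rewrite /f rmorphM /= qchiM //; move: H1; rewrite subr0; apply: contraNneq => E.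
  by rewrite -[qchi _]mul1r -q1 -mulrA E mulrN1.
have {H2}H2 : qchi (f (u2 * (m - n))) != -1.
  rewrite /f rmorphM rmorphB /= qchiM //; move: H2; apply: contraNneq => E.
  by rewrite -[qchi _]mul1r -q2 -mulrA E mulrN1.
have {H3}H3 : qchi (f (u1 * u2 * (m + 3 * n))) != -1.
  have q12 : qchi (f (u1 * u2)) * qchi (f (u1 * u2)) = 1.
    by rewrite /f rmorphM /= qchiM // mulrACA q1 q2.
  have fB : f m - f (- 3 * n) = f (m + 3 * n) by rewrite -rmorphB /=; congr f; ring.
  rewrite /f rmorphM /= qchiM //; move: H3; rewrite fB; apply: contraNneq => E.
  rewrite -[qchi (f _)]mul1r -{1}q12 -mulrA E mulrN1.
  by rewrite /f rmorphM /= qchiM.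
(* If m is congruent to a root, it is replaced by that root, so that the corresponding product is
   exactly 0 and not a nonzero multiple of p, to which Hensel's lemma would not apply. *)
have [X XmP] : exists2 X : int, (p %| X - m)%Z &
    [/\ X = 0 \/ ~~ (p %| X)%Z, X = n \/ ~~ (p %| X - n)%Z & X = - 3 * n \/ ~~ (p %| X + 3 * n)%Z].
  have p3n : ~~ (p %| 3 * n)%Z by rewrite dvdz_primeM // negb_or p3.
  have p4n : ~~ (p %| 4 * n)%Z by rewrite dvdz_primeM // negb_or p4.
  have [pm|pm] := boolP (p %| m)%Z.
    exists 0; first by rewrite sub0r rpredN.
    by split; [left|right; rewrite sub0r rpredN|right; rewrite add0r].
  have [pmn|pmn] := boolP (p %| m - n)%Z.
    exists n; first by rewrite -opprB rpredN.
    by split; [right|left|right; rewrite (_ : n + 3 * n = 4 * n) //; ring].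
  have [pm3|pm3] := boolP (p %| m + 3 * n)%Z.
    exists (- 3 * n); first by rewrite mulNr -opprD rpredN addrC.
    split; [right; rewrite mulNr rpredN //|right|by left].
    by rewrite (_ : - 3 * n - n = - (4 * n)) ?rpredN //; ring.
  by exists m; rewrite ?subrr //; split; right.
case=> X1 X2 X3.
have lift (u Y Z : int) : ~~ (p %| u)%Z -> qchi (f (u * Z)) != -1 -> (p %| Y - Z)%Z ->
    Y = 0 \/ ~~ (p %| Y)%Z -> isq ((u * Y)%:~R : K).
  move=> pu H YZ [->|pY]; first by rewrite mulr0; exact: isq0.
  have E : f (u * Z) = f (u * Y).
    by rewrite /f !rmorphM /=; congr (_ * _); apply/eqP; rewrite eq_sym intrFp_eq.
  apply: isq_unit; first by rewrite dvdz_primeM // negb_or pu.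
  rewrite -/(f _) -E; move: H; rewrite /qchi E fE dvdz_primeM // (negbTE pu) (negbTE pY) /=.
  by case: is_sq.
apply: (@solK_affine_int _ _ _ X); rewrite ?nz //.
- exact: lift H1 _ X1.
- apply: (lift _ _ (m - n)) => //; first by rewrite opprB addrA subrK.
  by case: X2 => [->|]; [left; rewrite subrr|right].
- apply: (lift _ _ (m + 3 * n)) => //; first by rewrite dvdz_primeM // negb_or pu1.
    by rewrite opprD addrACA subrr addr0.
  by case: X3 => [->|]; [left; rewrite mulNr addNr|right].
Qed.
End Good.

End Coprime6.
End OddPrime.

(** * Primes p other than 2 and 3 dividing n: the classes of the 2-torsion points *)

Section BadPrime.
Variables (p : nat) (p_pr : prime p).
Hypotheses (p_odd : odd p) (p_neq3 : p != 3).
Variables (nu u1 u2 : int).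
Hypotheses (pnu : ~~ (p %| nu)%Z) (pu1 : ~~ (p %| u1)%Z) (pu2 : ~~ (p %| u2)%Z).
Local Notation K := (Qp p_pr).
Local Notation f a := ((a : int)%:~R : 'F_p).

Let p_neq0 : p%:Z != 0.
Proof. by have := prime_gt0 p_pr; lia. Qed.

Let pM (a b : int) : ~~ (p %| a)%Z -> ~~ (p %| b)%Z -> ~~ (p %| a * b)%Z.
Proof. by move=> pa pb; rewrite dvdz_primeM // negb_or pa. Qed.

Let p2 : ~~ (p %| 2)%Z.
Proof. by rewrite dvdzE /= dvdn_prime2 //; apply: contraL p_odd => /eqP ->. Qed.
Let p3 : ~~ (p %| 3)%Z.
Proof. by rewrite dvdzE /= dvdn_prime2. Qed.
Let pN3 : ~~ (p %| (- 3 : int)%R)%Z.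
Proof. by rewrite rpredN; exact: p3. Qed.
Let pNnu : ~~ (p %| - nu)%Z.
Proof. by rewrite rpredN. Qed.

Lemma is_sq_intrM (a b : int) : ~~ (p %| a)%Z -> ~~ (p %| b)%Z ->
  is_sq (f (a * b)) = (is_sq (f a) == is_sq (f b)).
Proof. by move=> pa pb; rewrite rmorphM is_sqM ?card_Fp ?intrFp_eq0. Qed.

(** With n = p nu, the torsion classes (-3, -n) and (n, 1) have valuation parities (0, 1) and (1,
    0). So the unit parts of the torsion class with parities (e1, e2) are (-3)^e2 nu^e1 and
    (-nu)^e2, up to squares, and the conclusion says that (b1, b2) is this class. In each case,
    after division by p where possible, a coordinate prime to p is found and the equations are
    reduced modulo p. *)
Lemma bad_soluble_nec (e1 e2 : bool) :
  solK ((p%:Z ^+ e1 * u1)%:~R : K) (p%:Z ^+ e2 * u2)%:~R (p%:Z * nu)%:~R ->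
  is_sq (f (u1 * (-3) ^+ e2 * nu ^+ e1)) /\ is_sq (f (u2 * (- nu) ^+ e2)).
Proof.
move=> /solK_primitive /(_ 3)[w0 [w1 [w2 [w3 [c [d [nw E1 E2]]]]]]].
have pu12 := pM pu1 pu2.
have nP w : ~ (p %| w)%Z -> ~~ (p %| w)%Z by move/negP.
move: e1 e2 E1 E2 => [] [] ; rewrite ?expr1 ?expr0 ?mulr1 ?mul1r => E1 E2.
- have {}E1 : u1 * w1 ^+ 2 - u2 * w2 ^+ 2 - nu * w0 ^+ 2 = c * p%:Z ^+ 2.
    by apply: (mulfI p_neq0); apply: (lincomb E1); ring.
  have {}E2 : u1 * w1 ^+ 2 - p%:Z * u1 * u2 * w3 ^+ 2 + 3 * nu * w0 ^+ 2 = d * p%:Z ^+ 2.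
    by apply: (mulfI p_neq0); apply: (lincomb E2); ring.
  have pw0 : ~~ (p %| w0)%Z.
    apply: contra nw => /dvdzP[x0 W0].
    have /dvdzP[x1 W1] : (p %| w1)%Z.
      apply: (dvd_of_sq p_pr (m := u1 * u2 * w3 ^+ 2 - 3 * nu * x0 ^+ 2 * p%:Z + d * p%:Z) pu1).
      by apply: (lincomb E2); rewrite W0; ring.
    have /dvdzP[x2 W2] : (p %| w2)%Z.
      apply: (dvd_of_sq p_pr (m := (u1 * x1 ^+ 2 - nu * x0 ^+ 2 - c) * p%:Z) pu2).
      by apply: (lincomb (esym E1)); rewrite W0 W1; ring.
    have -> : (p %| w3)%Z.
      apply: (dvd_of_sq p_pr (m := u1 * x1 ^+ 2 + 3 * nu * x0 ^+ 2 - d) pu12).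
      by apply: (mulfI p_neq0); apply: (lincomb (esym E2)); rewrite W0 W1; ring.
    by rewrite W0 W1 W2 !dvdz_mull.
  split.
    rewrite (_ : u1 * -3 * nu = (- 3 * nu) * u1); last by ring.
    apply: (sq_of_cong p_pr (x := w0) (y := w1) (m := - u1 * u2 * w3 ^+ 2 - d * p%:Z)) => //.
      by apply: pM.
    by apply: (lincomb (esym E2)); ring.
  (* The difference of the two equations carries 4 nu, the difference of the roots; the square 4 is
     inserted to match it. *)
  rewrite -(is_sqMl p_pr p_odd _ p2) (_ : u2 * - nu * 2 ^+ 2 = (2 * 2 * - nu) * u2); last by ring.
  apply: (sq_of_cong p_pr (x := w0) (y := w2)
     (m := - u1 * u2 * w3 ^+ 2 + (c - d) * p%:Z)) => //.
    by rewrite !pM.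
  by apply: (lincomb (congr2 (fun x y => x - y) E1 E2)); rewrite /=; ring.
- have /dvdzP[x2 W2] : (p %| w2)%Z.
    apply: (dvd_of_sq p_pr (m := u1 * w1 ^+ 2 - nu * w0 ^+ 2 - c * p%:Z ^+ 2) pu2).
    by apply: (lincomb (esym E1)); ring.
  have {}E1 : u1 * w1 ^+ 2 - p%:Z * u2 * x2 ^+ 2 - nu * w0 ^+ 2 = c * p%:Z ^+ 2.
    by apply: (mulfI p_neq0); apply: (lincomb E1); rewrite W2; ring.
  have {}E2 : u1 * w1 ^+ 2 - u1 * u2 * w3 ^+ 2 + 3 * nu * w0 ^+ 2 = d * p%:Z ^+ 2.
    by apply: (mulfI p_neq0); apply: (lincomb E2); ring.
  have pw0 : ~~ (p %| w0)%Z.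
    apply: contra nw => /dvdzP[x0 W0].
    have /dvdzP[x1 W1] : (p %| w1)%Z.
      apply: (dvd_of_sq p_pr (m := u2 * x2 ^+ 2 + nu * x0 ^+ 2 * p%:Z + c * p%:Z) pu1).
      by apply: (lincomb E1); rewrite W0; ring.
    have -> : (p %| w3)%Z.
      apply: (dvd_of_sq p_pr (m := (u1 * x1 ^+ 2 + 3 * nu * x0 ^+ 2 - d) * p%:Z) pu12).
      by apply: (lincomb (esym E2)); rewrite W0 W1; ring.
    by rewrite W0 W1 W2 !dvdz_mull.
  have sq1 : is_sq (f (u1 * nu)).
    rewrite mulrC; apply: (sq_of_cong p_pr (x := w0) (y := w1)
      (m := - u2 * x2 ^+ 2 - c * p%:Z)) => //.
    by apply: (lincomb (esym E1)); ring.
  split=> //.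
  have : is_sq (f ((2 * 2 * nu) * (u1 * u2))).
    apply: (sq_of_cong p_pr (x := w0) (y := w3)
      (m := - u2 * x2 ^+ 2 + (d - c) * p%:Z)) => //.
      by rewrite !pM.
    by apply: (lincomb (congr2 (fun x y => x - y) E2 E1)); rewrite /=; ring.
  rewrite (_ : 2 * 2 * nu * (u1 * u2) = (u1 * nu) * u2 * 2 ^+ 2); last by ring.
  by rewrite is_sqMl // is_sq_intrM ?pM // sq1 => /eqP <-.
- have /dvdzP[x1 W1] : (p %| w1)%Z.
    apply: (dvd_of_sq p_pr (m := u2 * w2 ^+ 2 + nu * w0 ^+ 2 + c * p%:Z ^+ 2) pu1).
    by apply: (lincomb E1); ring.
  have {}E1 : p%:Z * u1 * x1 ^+ 2 - u2 * w2 ^+ 2 - nu * w0 ^+ 2 = c * p%:Z ^+ 2.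
    by apply: (mulfI p_neq0); apply: (lincomb E1); rewrite W1; ring.
  have {}E2 : p%:Z * u1 * x1 ^+ 2 - u1 * u2 * w3 ^+ 2 + 3 * nu * w0 ^+ 2 = d * p%:Z ^+ 2.
    by apply: (mulfI p_neq0); apply: (lincomb E2); rewrite W1; ring.
  have pw0 : ~~ (p %| w0)%Z.
    apply: contra nw => /dvdzP[x0 W0].
    have /dvdzP[x2 W2] : (p %| w2)%Z.
      apply: (dvd_of_sq p_pr (m := u1 * x1 ^+ 2 - nu * x0 ^+ 2 * p%:Z - c * p%:Z) pu2).
      by apply: (lincomb (esym E1)); rewrite W0; ring.
    have -> : (p %| w3)%Z.
      apply: (dvd_of_sq p_pr (m := u1 * x1 ^+ 2 + 3 * nu * x0 ^+ 2 * p%:Z - d * p%:Z) pu12).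
      by apply: (lincomb (esym E2)); rewrite W0; ring.
    by rewrite W0 W1 W2 !dvdz_mull.
  have sq2 : is_sq (f (u2 * - nu)).
    rewrite mulrC; apply: (sq_of_cong p_pr (x := w0) (y := w2)
      (m := - u1 * x1 ^+ 2 + c * p%:Z)) => //.
    by apply: (lincomb E1); ring.
  split=> //.
  have : is_sq (f ((3 * nu) * (u1 * u2))).
    apply: (sq_of_cong p_pr (x := w0) (y := w3) (m := - u1 * x1 ^+ 2 + d * p%:Z)) => //.
      by rewrite !pM.
    by apply: (lincomb E2); ring.
  rewrite (_ : 3 * nu * (u1 * u2) = (u2 * - nu) * (u1 * -3)); last by ring.
  by rewrite is_sq_intrM ?pM // sq2 => /eqP <-.
(* Both valuations even: modulo p the terms in n disappear, so the coordinate prime to p is now w1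
   and not w0. *)
- have pw1 : ~~ (p %| w1)%Z.
    apply: contra nw => /dvdzP[x1 W1].
    have /dvdzP[x2 W2] : (p %| w2)%Z.
      apply: (dvd_of_sq p_pr (m := u1 * x1 ^+ 2 * p%:Z - nu * w0 ^+ 2 - c * p%:Z ^+ 2) pu2).
      by apply: (lincomb (esym E1)); rewrite W1; ring.
    have /dvdzP[x3 W3] : (p %| w3)%Z.
      apply: (dvd_of_sq p_pr (m := u1 * x1 ^+ 2 * p%:Z + 3 * nu * w0 ^+ 2 - d * p%:Z ^+ 2) pu12).
      by apply: (lincomb (esym E2)); rewrite W1; ring.
    have -> : (p %| w0)%Z.
      apply: (dvd_of_sq p_pr (m := u1 * x1 ^+ 2 - u2 * x2 ^+ 2 - c * p%:Z) pnu).
      by apply: (mulfI p_neq0); apply: (lincomb (esym E1)); rewrite W1 W2; ring.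
    by rewrite W1 W2 W3 !dvdz_mull.
  have s12 : is_sq (f (u1 * u2)).
    apply: (sq_of_cong p_pr (x := w1) (y := w2) (m := nu * w0 ^+ 2 + c * p%:Z ^+ 2)) => //.
    by apply: (lincomb E1); ring.
  have s2 : is_sq (f u2).
    have : is_sq (f (u1 * (u1 * u2))).
      apply: (sq_of_cong p_pr (x := w1) (y := w3)
        (m := - 3 * nu * w0 ^+ 2 + d * p%:Z ^+ 2)) => //.
      by apply: (lincomb E2); ring.
    by rewrite (_ : u1 * (u1 * u2) = u2 * u1 ^+ 2) ?is_sqMl //; ring.
  by move: s12; rewrite is_sq_intrM // s2 => /eqP.
Qed.

(** Conversely the torsion point with the given parities lifts: its abscissa is -3n, n or 0, or it
    is the point at infinity. One of the three products is then 0 and the others are p^2 times a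
    unit that is a square modulo p. *)
Lemma bad_soluble (e1 e2 : bool) :
  solK ((p%:Z ^+ e1 * u1)%:~R : K) (p%:Z ^+ e2 * u2)%:~R (p%:Z * nu)%:~R <->
  is_sq (f (u1 * (-3) ^+ e2 * nu ^+ e1)) /\ is_sq (f (u2 * (- nu) ^+ e2)).
Proof.
split; first exact: bad_soluble_nec.
have nz (u : int) : ~~ (p %| u)%Z -> u != 0 by apply: contraNneq => ->; rewrite dvdz0.
have b1nz (e : bool) u : ~~ (p %| u)%Z -> p%:Z ^+ e * u != 0.
  by move=> pu; rewrite mulf_neq0 ?(nz u) ?expf_neq0.
have sq (a u : int) : ~~ (p %| u)%Z -> is_sq (f u) -> a = p%:Z ^+ 2 * u -> isq (a%:~R : K).
  by move=> pu su ->; apply: isq_unitM.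
have sq0 (a : int) : a = 0 -> isq (a%:~R : K) by move->; exact: isq0.
have p22 := pM p2 p2.
case: e1 e2 => [] []; rewrite ?expr1 ?expr0 ?mulr1 ?mul1r => -[s1 s2].
- apply: (@solK_affine_int _ _ _ _ _ (- 3 * (p%:Z * nu))).
  + exact: (b1nz true).
  + exact: (b1nz true).
  + by apply: (sq _ (u1 * -3 * nu)); rewrite ?pM //; ring.
  + apply: (sq _ (u2 * - nu * 2 ^+ 2)); rewrite ?is_sqMl ?pM //; ring.
  + by apply: sq0; ring.
- apply: (@solK_affine_int _ _ _ _ _ (p%:Z * nu)).
  + exact: (b1nz true).
  + exact: nz.
  + by apply: (sq _ (u1 * nu)); rewrite ?pM //; ring.
  + by apply: sq0; ring.
  + apply: (sq _ (u1 * nu * u2 * 2 ^+ 2)); rewrite ?is_sqMl ?pM //; last by ring.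
    by rewrite is_sq_intrM ?pM // s1 s2.
- apply: (@solK_affine_int _ _ _ _ _ 0).
  + exact: nz.
  + exact: (b1nz true).
  + by apply: sq0; ring.
  + by apply: (sq _ (u2 * - nu)); rewrite ?pM //; ring.
  + apply: (sq _ ((u1 * -3) * (u2 * - nu))); rewrite ?pM //; last by ring.
    by rewrite is_sq_intrM ?pM // s1 s2.
- by apply: solK_infty; rewrite ?intrQp_eq0 ?nz //; apply: isq_unit.
Qed.
End BadPrime.

(** * Local conditions at 2 and 3 *)

(* Solubility over Q_p for p = 2, 3 and natural coefficients, by enumeration: necessity is
   tested on squares modulo a power q of p, sufficiency on a list of abscissas X / d^2. *)
Definition mod_squares (q : nat) : seq nat := (undup [seq r ^ 2 %% q | r <- iota 0 q])%N.

(** The search runs over squares, not over their roots. The equations are arranged with plus signs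
    so as to make sense in [nat], and the multiples by b1 and b1 b2 are tabulated once. *)
Definition mod_soluble (p q b1 b2 n : nat) : bool :=
  let S := mod_squares q in
  let S1 := [seq (W, (b1 * W) %% q) | W <- S]%N in
  let S3 := [seq (W, (b1 * b2 * W) %% q) | W <- S]%N in
  (has (fun W2 => has (fun W0 => let c := (b2 * W2 + n * W0) %% q in
    has (fun W1 => (W1.2 == c) && let d := (W1.2 + 3 * n * W0) %% q in
      has (fun W3 => (W3.2 == d) && ~~ [&& p %| W0, p %| W1.1, p %| W2 & p %| W3.1])
        S3) S1) S) S)%N.

(** A sufficient test only. M is 8 for p = 2 and 3 for p = 3, so that an integer congruent to 1
    modulo M is a p-adic square; the bound on e is enough for the abscissas listed below. The value
    0 is accepted because the abscissa may be a root. *)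
Definition padic_square_nat (p M a : nat) : bool :=
  ((a == 0) || has (fun e => (p ^ (2 * e) %| a) && ((a %/ p ^ (2 * e)) %% M == 1)) (iota 0 4))%N.

(** The abscissa is X / d^2; the guard [n * d ^ 2 <= X] keeps the truncated subtraction exact. *)
Definition abscissa_soluble (p M : nat) (L : seq (nat * nat)) (b1 b2 n : nat) : bool :=
  (has (fun Xd => let: (X, d) := Xd in
    [&& 0 < d, n * d ^ 2 <= X, padic_square_nat p M (b1 * X),
        padic_square_nat p M (b2 * (X - n * d ^ 2))
      & padic_square_nat p M (b1 * b2 * (X + 3 * n * d ^ 2))]) L)%N.

Section SmallPrime.
Variables (p : nat) (p_pr : prime p).
Local Notation K := (Qp p_pr).

(** As p divides p^k, the residue W of w^2 is divisible by p iff w is; primitivity can therefore be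
    tested on squares. *)
Lemma mod_squareP (k : nat) (w : int) : (0 < k)%N ->
  exists W : nat, [/\ W \in mod_squares (p ^ k), (p %| W)%N = (p %| w)%Z
    & ((p ^ k)%N%:Z %| w ^+ 2 - W%:Z)%Z].
Proof.
move=> k0; set q := (p ^ k)%N; have q0 : (0 < q)%N by rewrite expn_gt0 prime_gt0.
pose r := `|(w %% q%:Z)%Z|%N.
have rE : r%:Z = (w %% q%:Z)%Z by rewrite /r gez0_abs // modz_ge0 // gt_eqF.
have rq : (r < q)%N by rewrite -ltz_nat rE ltz_pmod.
have wW : (q%:Z %| w ^+ 2 - (r ^ 2 %% q)%N%:Z)%Z.
  rewrite -eqz_mod_dvd -modz_nat modz_mod PoszXn rE.
  by rewrite !expr2 modzMml modzMmr.
exists (r ^ 2 %% q)%N; split=> //.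
  by rewrite mem_undup; apply: map_f; rewrite mem_iota.
have pq : (p%:Z %| q%:Z)%Z by rewrite /q -(prednK k0) expnS PoszM dvdz_mulr.
apply/idP/idP => [pW|pw].
  suff : (p %| w ^+ 2)%Z by rewrite expr2 dvdz_primeM // orbb.
  rewrite -[w ^+ 2](subrK ((r ^ 2 %% q)%N%:Z)) rpredD //.
  exact: dvdz_trans pq wW.
suff : (p%:Z %| (r ^ 2 %% q)%N%:Z)%Z by [].
rewrite -[(r ^ 2 %% q)%N%:Z](subKr (w ^+ 2)) rpredB //; last exact: dvdz_trans pq wW.
by rewrite expr2 dvdz_mulr.
Qed.

Lemma mod_soluble_nec (k b1 b2 n : nat) : (0 < k)%N ->
  solK (b1%:Z%:~R : K) b2%:Z%:~R n%:Z%:~R -> mod_soluble p (p ^ k) b1 b2 n.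
Proof.
move=> k0 /solK_primitive /(_ k)[w0 [w1 [w2 [w3 [c [d [nw E1 E2]]]]]]].
have [W0 [S0 D0 /dvdzP[m0 M0]]] := mod_squareP w0 k0.
have [W1 [S1 D1 /dvdzP[m1 M1]]] := mod_squareP w1 k0.
have [W2 [S2 D2 /dvdzP[m2 M2]]] := mod_squareP w2 k0.
have [W3 [S3 D3 /dvdzP[m3 M3]]] := mod_squareP w3 k0.
rewrite -PoszXn in E1 E2; set q := (p ^ k)%N in S0 S1 S2 S3 M0 M1 M2 M3 E1 E2 *.
have WE0 : W0%:Z = w0 ^+ 2 - m0 * q%:Z by rewrite -M0 subKr.
have WE1 : W1%:Z = w1 ^+ 2 - m1 * q%:Z by rewrite -M1 subKr.
have WE2 : W2%:Z = w2 ^+ 2 - m2 * q%:Z by rewrite -M2 subKr.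
have WE3 : W3%:Z = w3 ^+ 2 - m3 * q%:Z by rewrite -M3 subKr.
apply/hasP; exists W2 => //; apply/hasP; exists W0 => //.
apply/hasP; exists (W1, (b1 * W1) %% q)%N; first by apply: map_f.
apply/andP; split; last first.
  apply/hasP; exists (W3, (b1 * b2 * W3) %% q)%N; first by apply: map_f.
  rewrite D0 D1 D2 D3 nw andbT /= modnDml eq_sym.
  rewrite -eqz_nat -!modz_nat eqz_mod_dvd !(PoszD, PoszM); apply/dvdzP.
  exists (d - b1%:Z * m1 + b1%:Z * b2%:Z * m3 - 3 * n%:Z * m0).
  by rewrite WE0 WE1 WE3; apply: (lincomb E2); ring.
rewrite -eqz_nat -!modz_nat eqz_mod_dvd !(PoszD, PoszM); apply/dvdzP.
exists (c - b1%:Z * m1 + b2%:Z * m2 + n%:Z * m0).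
by rewrite WE0 WE1 WE2; apply: (lincomb E1); ring.
Qed.

Lemma abscissa_soluble_suf (M b1 b2 n : nat) L :
  (forall m : nat, (m %% M = 1)%N -> isq (m%:Z%:~R : K)) ->
  (0 < b1)%N -> (0 < b2)%N ->
  abscissa_soluble p M L b1 b2 n -> solK (b1%:Z%:~R : K) b2%:Z%:~R n%:Z%:~R.
Proof.
move=> HM b10 b20 /hasP[[X d] _ /and5P[d0 nX s1 s2 s3]].
have sq a : padic_square_nat p M a -> isq (a%:Z%:~R : K).
  case/orP => [/eqP->|/hasP[e _ /andP[/dvdnP[m ->]]]]; first exact: isq0.
  rewrite mulnK ?expn_gt0 ?prime_gt0 // => /eqP m1.
  rewrite PoszM rmorphM; apply: isqM; first exact: HM.
  by rewrite PoszXn mulnC exprM rmorphXn; exact: isq_sqr.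
have dK : (d%:Z%:~R : K) != 0 by rewrite intrQp_eq0; lia.
(* Replacing n by n d^2, in the same square class, turns the abscissa X / d^2 into the integer X. *)
apply: (@solK_sqeq _ b1%:Z%:~R b2%:Z%:~R (n * d ^ 2)%N%:Z%:~R).
- exact: sqeq_refl.
- exact: sqeq_refl.
- by exists d%:Z%:~R => //; rewrite PoszM PoszXn rmorphM rmorphXn.
apply: (@solK_affine_int _ _ _ _ _ X%:Z); [lia | lia | | |].
- by rewrite -PoszM; apply: sq.
- by rewrite subzn // -PoszM; apply: sq.
- by rewrite (_ : X%:Z + _ = (X + 3 * n * d ^ 2)%N) -?PoszM; [apply: sq|lia].
Qed.
End SmallPrime.

(* For n = - 3 m, the classes n = 5 and n = 1 modulo 8 are m = 1 and m = 5. *)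
Definition two_condition (e1 e2 : bool) (u1 u2 n : int) : bool :=
  if (n %% 8)%Z == 5 then [&& ~~ e1, ~~ e2 & e4 u1 == 0]
  else if (n %% 8)%Z == 1 then
    [&& ~~ e1, e2%:R + e4 u1 == 0 & e4 u2 + e2%:R + e8 u1 == 0]
  else [&& ~~ e1, ~~ e2 & e4 u2 == 0].

(** With n = 3 nu, the solutions are the four torsion classes, generated by (-3, -3 nu) and (3 nu,
    1): the exponents e1, e2 determine the unit parts modulo 3. *)
Definition three_condition (e1 e2 : bool) (u1 u2 nu : int) : bool :=
  (e3 u2 + e3 (- nu) * e2%:R == 0) &&
  (e3 (- nu) * e2%:R + e3 u1 + (1 + e3 (- nu)) * e1%:R == 0).

(* Pairs (X, d) found by computer search. *)
Definition two_abscissas : seq (nat * nat) :=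
  [:: (1,1); (9,2); (3,1); (11,1); (20,1); (80,1); (7,1); (15,1); (49,4); (17,2); (83,1);
      (31,3); (111,3); (81,4); (57,3); (25,2); (97,1); (5,1); (85,1); (113,4); (33,2);
      (171,1); (91,1); (87,1)]%N.

Definition three_abscissas : seq (nat * nat) :=
  [:: (4,1); (18,1); (3,1); (54,1); (7,1); (9,1); (6,1)]%N.

(** The residues 1, 3, 5, 7 represent all odd square classes of Q_2, so the table exhausts the
    cases. The obstruction modulo 16 and the listed abscissas meet: no case is left undecided. *)
Lemma two_table (e1 e2 : bool) (r1 r2 n : nat) :
  r1 \in [:: 1; 3; 5; 7]%N -> r2 \in [:: 1; 3; 5; 7]%N -> n \in [:: 1; 3; 5; 7]%N ->
  (mod_soluble 2 16 (2 ^ e1 * r1) (2 ^ e2 * r2) n ==> two_condition e1 e2 r1 r2 n) &&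
  (two_condition e1 e2 r1 r2 n ==>
     abscissa_soluble 2 8 two_abscissas (2 ^ e1 * r1) (2 ^ e2 * r2) n).
Proof.
have : all (fun e1 : bool => all (fun e2 : bool => all (fun r1 => all (fun r2 => all (fun n =>
    (mod_soluble 2 16 (2 ^ e1 * r1) (2 ^ e2 * r2) n ==> two_condition e1 e2 r1 r2 n) &&
    (two_condition e1 e2 r1 r2 n ==>
     abscissa_soluble 2 8 two_abscissas (2 ^ e1 * r1) (2 ^ e2 * r2) n))
   [:: 1; 3; 5; 7]%N) [:: 1; 3; 5; 7]%N) [:: 1; 3; 5; 7]%N) [:: true; false]) [:: true; false].
  by lazy.
have bP (e : bool) : e \in [:: true; false] by case: e.
by move=> /allP/(_ e1 (bP _))/allP/(_ e2 (bP _))/allP H Hr1 Hr2 Hn;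
   exact: (allP (allP (H _ Hr1) _ Hr2) _ Hn).
Qed.

Lemma three_table (e1 e2 : bool) (r1 r2 nu : nat) :
  r1 \in [:: 1; 2]%N -> r2 \in [:: 1; 2]%N -> nu \in [:: 1; 2]%N ->
  (mod_soluble 3 27 (3 ^ e1 * r1) (3 ^ e2 * r2) (3 * nu) ==> three_condition e1 e2 r1 r2 nu) &&
  (three_condition e1 e2 r1 r2 nu ==>
     abscissa_soluble 3 3 three_abscissas (3 ^ e1 * r1) (3 ^ e2 * r2) (3 * nu)).
Proof.
have : all (fun e1 : bool => all (fun e2 : bool => all (fun r1 => all (fun r2 => all (fun nu =>
    (mod_soluble 3 27 (3 ^ e1 * r1) (3 ^ e2 * r2) (3 * nu) ==> three_condition e1 e2 r1 r2 nu) &&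
    (three_condition e1 e2 r1 r2 nu ==>
     abscissa_soluble 3 3 three_abscissas (3 ^ e1 * r1) (3 ^ e2 * r2) (3 * nu)))
   [:: 1; 2]%N) [:: 1; 2]%N) [:: 1; 2]%N) [:: true; false]) [:: true; false].
  by lazy.
have bP (e : bool) : e \in [:: true; false] by case: e.
by move=> /allP/(_ e1 (bP _))/allP/(_ e2 (bP _))/allP H Hr1 Hr2 Hn;
   exact: (allP (allP (H _ Hr1) _ Hr2) _ Hn).
Qed.

Lemma sqeq_int (p : nat) (p_pr : prime p) (e : bool) (u r : int) :
  u != 0 -> r != 0 -> isq ((u * r)%:~R : Qp p_pr) ->
  sqeq ((p%:Z ^+ e * u)%:~R : Qp p_pr) (p%:Z ^+ e * r)%:~R.
Proof.
move=> u0 r0 ur; rewrite !rmorphM /=; apply: sqeqM; first exact: sqeq_refl.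
by apply: sqeq_isq; rewrite ?intrQp_eq0 // -rmorphM.
Qed.

Lemma two_soluble (p_pr : prime 2) (e1 e2 : bool) (u1 u2 n : int) :
  ~~ (2 %| u1)%Z -> ~~ (2 %| u2)%Z -> ~~ (2 %| n)%Z ->
  solK ((2%:Z ^+ e1 * u1)%:~R : Qp p_pr) (2%:Z ^+ e2 * u2)%:~R n%:~R <->
  two_condition e1 e2 u1 u2 n.
Proof.
move=> o1 o2 on.
have red (u : int) : ~~ (2 %| u)%Z -> exists r : nat,
    [/\ r \in [:: 1; 3; 5; 7]%N, (u %% 8)%Z = r, u != 0 & isq ((u * r%:Z)%:~R : Qp p_pr)].
  move=> ou; exists `|(u %% 8)%Z|%N; split; [rewrite !inE; lia | lia | lia |].
  (* With r the residue of u modulo 8, u r = r^2 = 1 modulo 8, so u and r lie in the same square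
     class. *)
  apply: padic2_hensel.
  have : (u %% 8)%Z = 1 \/ (u %% 8)%Z = 3 \/ (u %% 8)%Z = 5 \/ (u %% 8)%Z = 7 by lia.
  by case=> [|[|[|]]] E; rewrite E; lia.
have [r1 [R1 m1 u10 s1]] := red _ o1; have [r2 [R2 m2 u20 s2]] := red _ o2.
have [m [Rm mn n0 sn]] := red _ on.
have pos (r : nat) : r \in [:: 1; 3; 5; 7]%N -> (0 < r < 8)%N by rewrite !inE; lia.
have nz (r : nat) : r \in [:: 1; 3; 5; 7]%N -> r%:Z != 0 by move/pos; lia.
have nE (e : bool) (r : nat) : (2%:Z ^+ e * r%:Z) = (2 ^ e * r)%N by case: e.
have small (u : int) (r : nat) : r \in [:: 1; 3; 5; 7]%N -> (u %% 8)%Z = r ->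
    (e4 u = e4 r) * (e8 u = e8 r) * ((r %% 8)%Z = r).
  move=> Rr ur; rewrite /e4 /e8; have -> : (u %% 4)%Z = (r%:Z %% 4)%Z by lia.
  by rewrite ur; have rp := pos _ Rr; have -> : (r%:Z %% 8)%Z = r by lia.
have -> : two_condition e1 e2 u1 u2 n = two_condition e1 e2 r1 r2 m.
  by rewrite /two_condition mn !(small _ _ R1 m1) !(small _ _ R2 m2) !(small _ _ Rm mn).
have /andP[/implyP T1 /implyP T2] := two_table e1 e2 R1 R2 Rm.
have q1 := sqeq_int e1 u10 (nz _ R1) s1; have q2 := sqeq_int e2 u20 (nz _ R2) s2.
have qn := sqeq_int false n0 (nz _ Rm) sn; rewrite expr0 !mul1r in qn.
rewrite nE in q1; rewrite nE in q2; split.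
  move=> /(solK_sqeq q1 q2 qn) /(@mod_soluble_nec _ _ 4) H; apply: T1; exact: H.
move/T2 => H; apply: (solK_sqeq (sqeq_sym q1) (sqeq_sym q2) (sqeq_sym qn)).
apply: abscissa_soluble_suf H; last 2 first.
- by rewrite muln_gt0 expn_gt0; case/andP: (pos _ R1).
- by rewrite muln_gt0 expn_gt0; case/andP: (pos _ R2).
by move=> k k1; apply: padic2_hensel; rewrite -eqz_mod_dvd modz_nat k1.
Qed.

Lemma three_soluble (p_pr : prime 3) (e1 e2 : bool) (u1 u2 nu : int) :
  ~~ (3 %| u1)%Z -> ~~ (3 %| u2)%Z -> ~~ (3 %| nu)%Z ->
  solK ((3%:Z ^+ e1 * u1)%:~R : Qp p_pr) (3%:Z ^+ e2 * u2)%:~R (3%:Z * nu)%:~R <->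
  three_condition e1 e2 u1 u2 nu.
Proof.
move=> o1 o2 on.
have one (a : int) : (3 %| a - 1)%Z -> isq (a%:~R : Qp p_pr).
  move=> a1; apply: padic_hensel => //; first by lia.
  by apply/is_sqP; exists 1; apply/eqP; rewrite expr1n -(intrFp_eq p_pr a 1) in a1 *.
have red (u : int) : ~~ (3 %| u)%Z -> exists r : nat,
    [/\ r \in [:: 1; 2]%N, (u %% 3)%Z = r, u != 0 & isq ((u * r%:Z)%:~R : Qp p_pr)].
  move=> ou; exists `|(u %% 3)%Z|%N; split; [rewrite !inE; lia | lia | lia |].
  apply: one; have : (u %% 3)%Z = 1 \/ (u %% 3)%Z = 2 by lia.
  by case=> E; rewrite E; lia.
have [r1 [R1 m1 u10 s1]] := red _ o1; have [r2 [R2 m2 u20 s2]] := red _ o2.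
have [m [Rm mn n0 sn]] := red _ on.
have pos (r : nat) : r \in [:: 1; 2]%N -> (0 < r < 3)%N by rewrite !inE; lia.
have nz (r : nat) : r \in [:: 1; 2]%N -> r%:Z != 0 by move/pos; lia.
have nE (e : bool) (r : nat) : (3%:Z ^+ e * r%:Z) = (3 ^ e * r)%N by case: e.
have small (u : int) (r : nat) : r \in [:: 1; 2]%N -> (u %% 3)%Z = r ->
    (e3 u = e3 r) * (e3 (- u) = e3 (- r%:Z)).
  by move/pos => rp ur; split; rewrite /e3; congr (_%:R); congr nat_of_bool; lia.
have -> : three_condition e1 e2 u1 u2 nu = three_condition e1 e2 r1 r2 m.
  by rewrite /three_condition !(small _ _ R1 m1) !(small _ _ R2 m2) !(small _ _ Rm mn).
have /andP[/implyP T1 /implyP T2] := three_table e1 e2 R1 R2 Rm.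
have q1 := sqeq_int e1 u10 (nz _ R1) s1; have q2 := sqeq_int e2 u20 (nz _ R2) s2.
have qn := sqeq_int true n0 (nz _ Rm) sn; rewrite expr1 in qn.
rewrite nE in q1; rewrite nE in q2; split.
  move=> /(solK_sqeq q1 q2 qn); rewrite -PoszM => /(@mod_soluble_nec _ _ 3) H; apply: T1; exact: H.
move/T2 => H; apply: (solK_sqeq (sqeq_sym q1) (sqeq_sym q2) (sqeq_sym qn)).
rewrite -PoszM; apply: abscissa_soluble_suf H; last 2 first.
- by rewrite muln_gt0 expn_gt0; case/andP: (pos _ R1).
- by rewrite muln_gt0 expn_gt0; case/andP: (pos _ R2).
by move=> k k1; apply: one; lia.
Qed.

(** * Passage from the rationals to local and global representatives *)

Section CharZero.
Variable K : fieldType.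
Hypothesis K0 : forall m : int, (m%:~R == 0 :> K) = (m == 0).

(** [ratr] is computed from the reduced fraction; independence of the chosen fraction needs only
    that nonzero integers stay nonzero in K, which holds in R and in every Q_p. *)
Lemma ratr_frac (a b : int) : b != 0 -> ratr (a%:~R / b%:~R) = a%:~R / b%:~R :> K.
Proof.
move=> b0; set x := a%:~R / b%:~R : rat; rewrite /ratr.
have E : numq x * b = a * denq x.
  apply/eqP; rewrite -(eqr_int rat) !rmorphM /= numqE mulrAC mulfVK //.
  by rewrite intr_eq0.
apply/eqP; rewrite eqr_div ?K0 ?denq_neq0 // -!rmorphM /= E.
by rewrite mulrC.
Qed.

Lemma ratrM_char0 (x y : rat) : ratr (x * y) = ratr x * ratr y :> K.
Proof.
rewrite -{1}[x]divq_num_den -{1}[y]divq_num_den mulf_div -!rmorphM /=.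
by rewrite ratr_frac ?mulf_neq0 ?denq_neq0 // !rmorphM /= /ratr mulf_div.
Qed.

Lemma ratr_eq0_char0 (x : rat) : (ratr x == 0 :> K) = (x == 0).
Proof. by rewrite /ratr mulf_eq0 invr_eq0 !K0 (negbTE (denq_neq0 x)) orbF numq_eq0. Qed.

Lemma covering_solK (n : int) (b1 b2 : rat) :
  covering_has_point 0 n%:~R (- 3 * n)%:~R K b1 b2 <-> solK (ratr b1 : K) (ratr b2) n%:~R.
Proof.
by rewrite /covering_has_point /solK !subr0 !ratr_int ratrM_char0 rmorphM.
Qed.

Lemma ratr_sqeq (x y : rat) : sqeq x y -> sqeq (ratr x : K) (ratr y).
Proof.
case=> c c0 ->; exists (ratr c); first by rewrite ratr_eq0_char0.
by rewrite !expr2 !ratrM_char0.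
Qed.

End CharZero.

(** * The real place *)

Section RealPlace.
Variable R : realType.

(** The roots satisfy nu < 0 < -3 nu, and real points have x >= nu, whence the sign of b2. If b2 <
    0, one equation has sides of opposite signs, which makes all terms vanish. If b2 > 0, the point
    at infinity serves for b1 > 0 and the torsion point X = 0 for b1 < 0. *)
Lemma real_solK (b1 b2 nu : R) : b1 != 0 -> b2 != 0 -> nu < 0 ->
  solK b1 b2 nu <-> 0 < b2.
Proof.
move=> b10 b20 n0; have sqr (x : R) : 0 <= x -> isq x.
  by move=> x0; exists (Num.sqrt x); rewrite sqr_sqrtr.
have z2 (x y : R) : x != 0 -> x * y ^+ 2 = 0 -> y = 0.
  by move=> x0 /eqP; rewrite mulf_eq0 (negbTE x0) sqrf_eq0 => /eqP.
have zeros z0 z1 z2' z3 : nu * z0 ^+ 2 = 0 -> b1 * z1 ^+ 2 = 0 -> b2 * z2' ^+ 2 = 0 ->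
    b1 * b2 * z3 ^+ 2 = 0 -> [|| z0 != 0, z1 != 0, z2' != 0 | z3 != 0] = false.
  move=> /z2-> ; last by rewrite lt_eqF.
  by move=> /z2-> // /z2-> // /z2->; rewrite ?eqxx ?mulf_neq0.
split=> [[z0 [z1 [z2' [z3 [nz E1 E2]]]]] | b2pos]; last first.
  have [b1pos|b1neg] := ltP 0 b1; first by apply: solK_infty => //; apply: sqr; exact: ltW.
  apply: (@solK_affine _ _ _ _ 0) => //; first by rewrite mulr0; exact: isq0.
    by apply: sqr; rewrite sub0r mulr_ge0 ?oppr_ge0 // ltW.
  by apply: sqr; rewrite add0r; apply: mulr_le0; [apply: mulr_le0_ge0 => //; exact: ltW | lra].
rewrite lt_neqAle eq_sym b20 /= leNgt; apply/negP => b2neg.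
have [s0 s1 s2 s3] : [/\ 0 <= z0 ^+ 2, 0 <= z1 ^+ 2, 0 <= z2' ^+ 2 & 0 <= z3 ^+ 2].
  by rewrite !sqr_ge0.
have [b1pos|b1neg] := ltP 0 b1.
  have F0 : nu * z0 ^+ 2 = 0 by nra.
  have F1 : b1 * z1 ^+ 2 = 0 by nra.
  have F2 : b2 * z2' ^+ 2 = 0 by nra.
  have F3 : b1 * b2 * z3 ^+ 2 = 0 by nra.
  by rewrite zeros in nz.
have b12 : 0 < b1 * b2 by rewrite nmulr_lgt0 // lt_neqAle b10.
have F3 : b1 * b2 * z3 ^+ 2 = 0.
  have := mulr_ge0 (ltW b12) s3; have := mulr_le0_ge0 b1neg s1.
  have := mulr_le0_ge0 (ltW n0) s0; nra.
have F1 : b1 * z1 ^+ 2 = 0.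
  have := mulr_le0_ge0 b1neg s1; have := mulr_le0_ge0 (ltW n0) s0; nra.
have F0 : nu * z0 ^+ 2 = 0 by nra.
have F2 : b2 * z2' ^+ 2 = 0 by nra.
by rewrite zeros in nz.
Qed.
End RealPlace.

Lemma sqeq_rat_int (b : rat) : sqeq b (numq b * denq b)%:~R.
Proof.
exists ((denq b)%:~R)^-1; first by rewrite invr_eq0 intr_eq0 denq_neq0.
rewrite -{1}[b]divq_num_den rmorphM /=.
by field; rewrite intr_eq0 denq_neq0.
Qed.

Lemma int_val_parity (p : nat) (m : int) : prime p -> m != 0 ->
  exists2 u : int, ~~ (p %| u)%Z &
    m = p%:Z ^+ odd (logn p `|m|) * u * (p%:Z ^+ (logn p `|m|)./2) ^+ 2.
Proof.
move=> p_pr m0; have am : (0 < `|m|)%N by rewrite absz_gt0.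
have [k pk mE] := pfactor_coprime p_pr am; set v := logn p `|m|%N in mE *.
exists (Num.sg m * k%:Z).
  by rewrite dvdzE abszM absz_sg m0 mul1n -prime_coprime.
rewrite {1}[m]numEsg -abszE mE PoszM PoszXn.
have -> : p%:Z ^+ v = p%:Z ^+ odd v * (p%:Z ^+ v./2) ^+ 2.
  by rewrite -exprM -exprD muln2 odd_double_half.
by ring.
Qed.

Lemma even_logn_square (M : nat) : (0 < M)%N ->
  (forall q, prime q -> ~~ odd (logn q M)) -> exists c, M = (c ^ 2)%N.
Proof.
elim/ltn_ind: M => M IH M0 H; have [M1|M1] := leqP M 1; first by exists 1%N; lia.
have q_pr := pdiv_prime M1; set q := pdiv M in q_pr.
have qM : (q ^ 2 %| M)%N.
  rewrite pfactor_dvdn // ltn_neqAle logn_gt0 mem_primes q_pr M0 pdiv_dvd andbT.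
  by have := H q q_pr; case: (logn q M) => [|[|]].
have [M' ME] := dvdnP qM.
have q0 := prime_gt1 q_pr.
have M'0 : (0 < M')%N by move: M0; rewrite ME muln_gt0 => /andP[].
have [||c cE] := IH M' _ M'0.
- by rewrite ME; nia.
- by move=> r r_pr; have := H r r_pr; rewrite ME lognM ?expn_gt0 ?(ltnW q0) // lognX oddD oddM addbF.
by exists (c * q)%N; rewrite ME cE expnMn.
Qed.

(** * The kernels of the matrices *)

Section Kernel.
Variables (t : nat) (p : 'I_t -> nat).
Implicit Types v : 'cV['F_2]_(6 + (t + t)).
Local Notation "[ d | i ]" := (legendre_add d (p i)) (format "[ d | i ]").

Definition top v (k : nat) : 'F_2 := v (lshift (t + t) (inord k)) 0.
Definition ypart v (i : 'I_t) : 'F_2 := v (rshift 6 (lshift t i)) 0.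
Definition xpart v (i : 'I_t) : 'F_2 := v (rshift 6 (rshift t i)) 0.

Definition row_eq v (ul : seq 'F_2) (ur : 'rV['F_2]_(t + t)) : Prop :=
  ul`_0 * top v 0 + ul`_1 * top v 1 + ul`_2 * top v 2 + ul`_3 * top v 3
   + ul`_4 * top v 4 + ul`_5 * top v 5 + (ur *m dsubmx v) 0 0 = 0.

Definition A_dot (z : 'I_t -> 'F_2) (i : 'I_t) : 'F_2 :=
  (\sum_(j | j != i) [p j | i]) * z i + \sum_(j | j != i) [p j | i] * z j.

Lemma sum_ord6 (F : 'I_6 -> 'F_2) : \sum_i F i = F (inord 0) + F (inord 1) + F (inord 2)
  + F (inord 3) + F (inord 4) + F (inord 5).
Proof.
transitivity (\sum_(i < 6) F (inord i)); first by apply: eq_bigr => i _; rewrite inord_val.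
rewrite -(big_mkord xpredT (fun k => F (inord k))).
by rewrite !big_nat_recr //= big_geq // add0r.
Qed.

Lemma row_dotE (a b : 'rV['F_2]_t) v :
  (row_mx a b *m dsubmx v) 0 0 = \sum_i a 0 i * ypart v i + \sum_i b 0 i * xpart v i.
Proof.
rewrite -[dsubmx v]vsubmxK mul_row_col mxE; congr (_ + _).
  by rewrite mxE; apply: eq_bigr => i _; rewrite !mxE.
by rewrite mxE; apply: eq_bigr => i _; rewrite !mxE.
Qed.

Lemma A_dotE (z : 'cV['F_2]_t) i : (A_ p *m z) i 0 = A_dot (fun j => z j 0) i.
Proof.
rewrite mxE (bigD1 i) //= /A_dot !mxE eqxx; congr (_ + _).
by apply: eq_bigr => j ji; rewrite !mxE eq_sym (negbTE ji).
Qed.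

Lemma C_kernelP ul ur v : (C_matrix p ul ur *m v = 0) <->
  [/\ forall k : nat, (k < 6)%N -> row_eq v (nth [::] ul k) (nth 0 ur k),
      forall i, [-1 | i] * top v 3 + [2 | i] * top v 4 + [3 | i] * top v 5
        + [-3 | i] * ypart v i + (A_dot (xpart v) i + [-3 | i] * xpart v i) = 0
    & forall i, [-1 | i] * top v 0 + [2 | i] * top v 1 + [3 | i] * top v 2
        + (A_dot (ypart v) i + [3 | i] * ypart v i) = 0].
Proof.
have e6 k : (k < 6)%N -> nat_of_ord (inord k : 'I_6) = k by exact: inordK.
have E1 i : (C_matrix p ul ur *m v) (lshift (t + t) i) 0 = 0 <->
    row_eq v (nth [::] ul i) (nth 0 ur i).
  have urE : ((\matrix_(i < 6) nth 0 ur i) *m dsubmx v) i 0 = (nth 0 ur i *m dsubmx v) 0 0.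
    by rewrite !mxE; apply: eq_bigr => j _; rewrite !mxE.
  rewrite -{1}[v]vsubmxK mul_block_col col_mxEu mxE urE /row_eq /top.
  by move: (_ 0 0) => X; rewrite mxE sum_ord6 !mxE !e6.
have low a b : (C_matrix p ul ur *m v) (rshift 6 a) b
     = (C_lower_left p *m usubmx v) a b + (C_lower_right p *m dsubmx v) a b.
  by rewrite -{1}[v]vsubmxK mul_block_col col_mxEd mxE.
have LL a : (C_lower_left p *m usubmx v) a 0 =
    (row_mx 0 (r_ p (-1))) 0 a * top v 0 + (row_mx 0 (r_ p 2)) 0 a * top v 1
  + (row_mx 0 (r_ p 3)) 0 a * top v 2 + (row_mx (r_ p (-1)) 0) 0 a * top v 3
  + (row_mx (r_ p 2) 0) 0 a * top v 4 + (row_mx (r_ p 3) 0) 0 a * top v 5.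
  pose rows := [:: row_mx 0 (r_ p (-1)); row_mx 0 (r_ p 2); row_mx 0 (r_ p 3);
                   row_mx (r_ p (-1)) 0; row_mx (r_ p 2) 0; row_mx (r_ p 3) 0].
  have Lk k : (k < 6)%N ->
      C_lower_left p a (inord k) * usubmx v (inord k) 0 = rows`_k 0 a * top v k.
    by move=> k6; rewrite [C_lower_left p a _]mxE mxE e6 // mxE.
  by rewrite mxE sum_ord6 !Lk.
have Y i : usubmx (dsubmx v) i 0 = ypart v i by rewrite 2!mxE.
have X i : dsubmx (dsubmx v) i 0 = xpart v i by rewrite 2!mxE.
have D d (z : 'cV_t) i : (D_ p d *m z) i 0 = [d | i] * z i 0.
  by rewrite mul_diag_mx !mxE.
have LRu i : (C_lower_right p *m dsubmx v) (lshift t i) 0 =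
    [-3 | i] * ypart v i + (A_dot (xpart v) i + [-3 | i] * xpart v i).
  rewrite -{1}[dsubmx v]vsubmxK mul_block_col col_mxEu mulmxDl mxE D Y mxE A_dotE D X.
  by rewrite (funext X).
have LRd i : (C_lower_right p *m dsubmx v) (rshift t i) 0 =
    A_dot (ypart v) i + [3 | i] * ypart v i.
  rewrite -{1}[dsubmx v]vsubmxK mul_block_col col_mxEd mul0mx addr0 mulmxDl mxE A_dotE D Y.
  by rewrite (funext Y).
have E2 i : (C_matrix p ul ur *m v) (rshift 6 (lshift t i)) 0 =
    [-1 | i] * top v 3 + [2 | i] * top v 4 + [3 | i] * top v 5
        + [-3 | i] * ypart v i + (A_dot (xpart v) i + [-3 | i] * xpart v i).
  rewrite low LL LRu !row_mxEl ![(0 : 'rV_t) _ _]mxE ![r_ p _ _ _]mxE !mul0r !add0r.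
  by rewrite !addrA.
have E3 i : (C_matrix p ul ur *m v) (rshift 6 (rshift t i)) 0 =
    [-1 | i] * top v 0 + [2 | i] * top v 1 + [3 | i] * top v 2
        + (A_dot (ypart v) i + [3 | i] * ypart v i).
  rewrite low LL LRd !row_mxEr ![(0 : 'rV_t) _ _]mxE ![r_ p _ _ _]mxE !mul0r.
  by rewrite !addr0.
split=> [M0 | [H1 H2 H3]].
  split=> [k k6|i|i]; [|by rewrite -E2 M0 mxE|by rewrite -E3 M0 mxE].
  by rewrite -(e6 k k6); apply/E1; rewrite M0 mxE.
apply/matrixP => a b; rewrite !ord1 [RHS]mxE.
have [i ->|i ->] := split_ordP a; first exact/E1/H1.
by have [j ->|j ->] := split_ordP i; [rewrite E2 H2 | rewrite E3 H3].
Qed.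
End Kernel.

Lemma F2_natE (z : 'F_2) : (z : nat) = (z != 0).
Proof. by case: z => [[|[|]]]. Qed.

Lemma F2_boolE (z : 'F_2) : z = (z != 0)%:R.
Proof. by apply/val_inj; case: z => [[|[|]]]. Qed.

Lemma e4M (a b : int) : ~~ (2 %| a)%Z -> ~~ (2 %| b)%Z -> e4 (a * b) = e4 a + e4 b.
Proof.
move=> oa ob; have ea : (a %% 4)%Z = 1 \/ (a %% 4)%Z = 3 by lia.
have eb : (b %% 4)%Z = 1 \/ (b %% 4)%Z = 3 by lia.
by rewrite /e4 -modzMm; case: ea => ->; case: eb => ->; apply/eqP.
Qed.

Lemma e8M (a b : int) : ~~ (2 %| a)%Z -> ~~ (2 %| b)%Z -> e8 (a * b) = e8 a + e8 b.
Proof.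
have odd8 (x : int) : ~~ (2 %| x)%Z ->
  (x %% 8)%Z = 1 \/ (x %% 8)%Z = 3 \/ (x %% 8)%Z = 5 \/ (x %% 8)%Z = 7 by lia.
move=> /odd8 ea /odd8 eb; rewrite /e8 -modzMm.
by case: ea => [|[|[|]]] ->; case: eb => [|[|[|]]] ->; apply/eqP.
Qed.

Lemma e3M (a b : int) : ~~ (3 %| a)%Z -> ~~ (3 %| b)%Z -> e3 (a * b) = e3 a + e3 b.
Proof.
move=> oa ob; have ea : (a %% 3)%Z = 1 \/ (a %% 3)%Z = 2 by lia.
have eb : (b %% 3)%Z = 1 \/ (b %% 3)%Z = 2 by lia.
by rewrite /e3 -modzMm; case: ea => ->; case: eb => ->; apply/eqP.
Qed.

(** * Exponent vectors as integers, and characters of such integers *)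

Section Decoding.
Variables (t : nat) (p : 'I_t -> nat).

Definition signed_prod (s a c : bool) (x : 'I_t -> bool) : int :=
  (-1) ^+ s * 2 ^+ a * 3 ^+ c * \prod_i (p i)%:Z ^+ x i.

Lemma decode_b1E (v : 'cV['F_2]_(6 + (t + t))) : decode_b1 p v =
  (signed_prod (top v 3 != 0) (top v 4 != 0) (top v 5 != 0) (fun i => xpart v i != 0))%:~R.
Proof.
rewrite /decode_b1 /Defs.expo /Defs.x_expo /signed_prod !F2_natE !rmorphM !rmorphXn rmorphN1 rmorph_prod.
by congr (_ * _); apply: eq_bigr => i _; rewrite F2_natE rmorphXn.
Qed.

Lemma decode_b2E (v : 'cV['F_2]_(6 + (t + t))) : decode_b2 p v =
  (signed_prod (top v 0 != 0) (top v 1 != 0) (top v 2 != 0) (fun i => ypart v i != 0))%:~R.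
Proof.
rewrite /decode_b2 /Defs.expo /Defs.y_expo /signed_prod !F2_natE !rmorphM !rmorphXn rmorphN1 rmorph_prod.
by congr (_ * _); apply: eq_bigr => i _; rewrite F2_natE rmorphXn.
Qed.

Lemma signed_prod_factor2 s a c x : signed_prod s a c x = 2%:Z ^+ a * signed_prod s false c x.
Proof. by rewrite /signed_prod expr0; ring. Qed.

Lemma signed_prod_factor3 s a c x : signed_prod s a c x = 3%:Z ^+ c * signed_prod s a false x.
Proof. by rewrite /signed_prod expr0; ring. Qed.

Lemma signed_prod_factor_at i s a c x :
  signed_prod s a c x = (p i)%:Z ^+ x i * signed_prod s a c (fun j => (j != i) && x j).
Proof.
rewrite /signed_prod (bigD1 i) //= [in RHS](bigD1 i) //= eqxx expr0 mul1r.
rewrite [X in _ = _ * (_ * X)](eq_bigr (fun j => (p j)%:Z ^+ x j)); first by ring.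
by move=> j ->.
Qed.

Section Character.
Variables (phi : int -> 'F_2) (P : pred int).
Hypotheses (P1 : P 1) (PM : forall a b, P a -> P b -> P (a * b)).
Hypothesis phiM : forall a b, P a -> P b -> phi (a * b) = phi a + phi b.

Let phi1 : phi 1 = 0.
Proof. by apply/(addrI (phi 1)); rewrite -phiM // mulr1 addr0. Qed.

Lemma char_expb (u : int) (e : bool) : (e -> P u) -> P (u ^+ e) /\ phi (u ^+ e) = e%:R * phi u.
Proof. by case: e => Pu; rewrite ?expr1 ?expr0 ?mul1r ?mul0r; split=> //; exact: Pu. Qed.

(** P is required only of the primes that occur. This allows the characters modulo 2, 3 and p_i once
    the exponent of that prime is set to 0. *)
Lemma char_signed_prod (s a c : bool) (x : 'I_t -> bool) :
  P (-1) -> (a -> P 2) -> (c -> P 3) -> (forall i, x i -> P (p i)%:Z) ->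
  P (signed_prod s a c x) /\ phi (signed_prod s a c x) = s%:R * phi (-1) + a%:R * phi 2 + c%:R * phi 3
    + \sum_i (x i)%:R * phi (p i)%:Z.
Proof.
move=> PN /char_expb[Pa fa] /char_expb[Pc fc] Px.
have [Ps fs] := @char_expb (-1) s (fun _ => PN).
have [Pp fp] : P (\prod_i (p i)%:Z ^+ x i) /\
    phi (\prod_i (p i)%:Z ^+ x i) = \sum_i (x i)%:R * phi (p i)%:Z.
  elim/big_rec2: _ => // i y1 y2 _ [Py <-].
  by have [Pi <-] := char_expb (Px i); split; [apply: PM | rewrite phiM].
by rewrite /signed_prod; split; rewrite ?phiM ?fa ?fc ?fs ?fp; do ?apply: PM.
Qed.
End Character.
End Decoding.

(** * Local conditions in terms of the exponents *)

Section LocalConditions.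
Variables (t : nat) (p : 'I_t -> nat).
Hypotheses (p_prime : forall i, prime (p i)) (p_inj : injective p).
Hypothesis p_neq23 : forall i, p i != 2%N /\ p i != 3%N.
Local Notation "[ d | i ]" := (legendre_add d (p i)) (format "[ d | i ]").
Local Notation dec := (signed_prod p).

Let N : int := \prod_i (p i)%:Z.
Let n : int := - 3 * N.

Lemma p_odd i : odd (p i).
Proof. by have [p2 _] := p_neq23 i; case: (even_prime (p_prime i)) => // E; rewrite E in p2. Qed.

Lemma ndvd2 i : ~~ (2 %| (p i)%:Z)%Z.
Proof. by rewrite dvdzE /= dvdn_prime2 // eq_sym; case: (p_neq23 i). Qed.

Lemma ndvd3 i : ~~ (3 %| (p i)%:Z)%Z.
Proof. by rewrite dvdzE /= dvdn_prime2 // eq_sym; case: (p_neq23 i). Qed.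

Lemma ndvd_small i (q : nat) : prime q -> p i != q -> ~~ (p i %| q%:Z)%Z.
Proof. by move=> q_pr pq; rewrite dvdzE /= dvdn_prime2. Qed.

Lemma ndvdN1 q : prime q -> ~~ (q %| (-1 : int)%R)%Z.
Proof. by move=> q_pr; rewrite rpredN dvdzE /= dvdn1; case: q q_pr => [|[]]. Qed.

Lemma ndvdM q : prime q -> forall a b : int, ~~ (q %| a)%Z -> ~~ (q %| b)%Z -> ~~ (q %| a * b)%Z.
Proof. by move=> q_pr a b qa qb; rewrite dvdz_primeM // negb_or qa. Qed.

Lemma ndvd1 q : prime q -> ~~ (q %| (1 : int)%R)%Z.
Proof. by move=> q_pr; have := ndvdN1 q_pr; rewrite rpredN. Qed.

Lemma char2_signed_prod (phi : int -> 'F_2) s c x :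
  (forall a b : int, ~~ (2 %| a)%Z -> ~~ (2 %| b)%Z -> phi (a * b) = phi a + phi b) ->
  ~~ (2 %| dec s false c x)%Z /\
  phi (dec s false c x) = s%:R * phi (-1) + c%:R * phi 3 + \sum_i (x i)%:R * phi (p i)%:Z.
Proof.
move=> phiM; have [|//|//|i _|Pd ->] := @char_signed_prod t p phi (fun a => ~~ (2 %| a)%Z)
    (ndvd1 (isT : prime 2)) (ndvdM (isT : prime 2)) phiM s false c x.
- exact: (@ndvdN1 2).
- exact: ndvd2.
by split=> //; rewrite mul0r addr0.
Qed.

Lemma e4_signed_prod s c x :
  e4 (dec s false c x) = s%:R + c%:R + \sum_i (x i)%:R * [-1 | i].
Proof.
have [_ ->] := char2_signed_prod s c x e4M; rewrite !mulr1; congr (_ + _).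
by apply: eq_bigr => i _; rewrite legendre_addN1 // p_odd.
Qed.

Lemma e8_signed_prod s c x : e8 (dec s false c x) = c%:R + \sum_i (x i)%:R * [2 | i].
Proof.
have [_ ->] := char2_signed_prod s c x e8M; rewrite mulr1 mulr0 add0r; congr (_ + _).
by apply: eq_bigr => i _; rewrite legendre_add2 // p_odd.
Qed.

Lemma e3_signed_prod s a x : ~~ (3 %| dec s a false x)%Z /\
  e3 (dec s a false x) = s%:R + a%:R + \sum_i (x i)%:R * [-3 | i].
Proof.
have [|//|//|i _|Pd ->] := @char_signed_prod t p e3 (fun a => ~~ (3 %| a)%Z)
    (ndvd1 (isT : prime 3)) (ndvdM (isT : prime 3)) e3M s a false x.
- exact: (@ndvdN1 3).
- exact: ndvd3.
split=> //; rewrite mul0r addr0 !mulr1; congr (_ + _).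
by apply: eq_bigr => i _; rewrite legendre_addN3 ?p_odd //; case: (p_neq23 i).
Qed.

Lemma legendre_signed_prod i s a c x : ~~ x i -> ~~ (p i %| dec s a c x)%Z /\
  [dec s a c x | i] = s%:R * [-1 | i] + a%:R * [2 | i] + c%:R * [3 | i]
     + \sum_(j | j != i) (x j)%:R * [p j | i].
Proof.
move=> xi; have [p2 p3] := p_neq23 i.
have [|||j xj|Pd ->] := @char_signed_prod t p (legendre_add ^~ (p i)) (fun a => ~~ (p i %| a)%Z)
    (ndvd1 (p_prime i)) (ndvdM (p_prime i)) (legendre_addM (p_prime i) (p_odd i)) s a c x.
- exact: ndvdN1.
- by move=> _; exact: (@ndvd_small i 2).
- by move=> _; exact: (@ndvd_small i 3).
- by apply: ndvd_small => //; apply: contraNneq xi => /p_inj ->.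
split=> //; congr (_ + _); rewrite (bigD1 i) //= (negbTE xi) mul0r add0r.
by [].
Qed.

Lemma N_signed_prod : N = dec false false false (fun => true).
Proof. by rewrite /signed_prod !expr0 !mul1r. Qed.

Lemma soluble2 (pr2 : prime 2) s1 a1 c1 x s2 a2 c2 y :
  solK ((dec s1 a1 c1 x)%:~R : Qp pr2) (dec s2 a2 c2 y)%:~R n%:~R <->
  two_condition a1 a2 (dec s1 false c1 x) (dec s2 false c2 y) n.
Proof.
have odd_dec s c z : ~~ (2 %| dec s false c z)%Z by have [] := char2_signed_prod s c z e4M.
rewrite signed_prod_factor2 (signed_prod_factor2 _ s2); apply: two_soluble => //.
by rewrite /n N_signed_prod; apply: ndvdM.
Qed.

Lemma soluble3 (pr3 : prime 3) s1 a1 c1 x s2 a2 c2 y :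
  solK ((dec s1 a1 c1 x)%:~R : Qp pr3) (dec s2 a2 c2 y)%:~R n%:~R <->
  three_condition c1 c2 (dec s1 a1 false x) (dec s2 a2 false y) (- N).
Proof.
rewrite signed_prod_factor3 (signed_prod_factor3 _ s2) /n (_ : - 3 * N = 3%:Z * - N); last by ring.
have n3 s a z : ~~ (3 %| dec s a false z)%Z by have [] := e3_signed_prod s a z.
by apply: three_soluble; rewrite // rpredN N_signed_prod.
Qed.

Lemma is_sq_legendre i (u : int) : ~~ (p i %| u)%Z ->
  is_sq (u%:~R : 'F_(p i)) <-> [u | i] = 0.
Proof. by move=> pu; rewrite legendre_addE //; case: is_sq. Qed.

(** Here n = p_i nu with nu = -3w and w = N / p_i. The symbol of w at p_i is the diagonal entry a_ii
    of A. The factor nu^e1 thus contributes x_i ([-3/p_i] + a_ii), the factor (-nu)^e2 contributes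
    y_i ([3/p_i] + a_ii), and (-3)^e2 gives the block D_{-3}. *)
Lemma solublep i s1 a1 c1 x s2 a2 c2 y :
  solK ((dec s1 a1 c1 x)%:~R : Qp (p_prime i)) (dec s2 a2 c2 y)%:~R n%:~R <->
  s1%:R * [-1 | i] + a1%:R * [2 | i] + c1%:R * [3 | i] + \sum_(j | j != i) (x j)%:R * [p j | i]
    + (y i)%:R * [-3 | i] + (x i)%:R * ([-3 | i] + \sum_(j | j != i) [p j | i]) = 0 /\
  s2%:R * [-1 | i] + a2%:R * [2 | i] + c2%:R * [3 | i] + \sum_(j | j != i) (y j)%:R * [p j | i]
    + (y i)%:R * ([3 | i] + \sum_(j | j != i) [p j | i]) = 0.
Proof.
have [p2 p3] := p_neq23 i.
have d3 : ~~ (p i %| (3 : int)%R)%Z by exact: (@ndvd_small i 3).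
have dN3 : ~~ (p i %| (-3 : int)%R)%Z by rewrite rpredN.
have pM := ndvdM (p_prime i); have LM := legendre_addM (p_prime i) (p_odd i).
pose skip (z : 'I_t -> bool) := fun j => (j != i) && z j.
have nskip z : ~~ skip z i by rewrite /skip eqxx.
have [d1 L1] := legendre_signed_prod s1 a1 c1 (nskip x).
have [d2 L2] := legendre_signed_prod s2 a2 c2 (nskip y).
have [d0 L0] := legendre_signed_prod false false false (nskip (fun => true)).
set u1 := dec s1 a1 c1 (skip x) in d1 L1; set u2 := dec s2 a2 c2 (skip y) in d2 L2.
set w := dec false false false (skip (fun => true)) in d0 L0.
rewrite (signed_prod_factor_at p i s1) (signed_prod_factor_at p i s2) -/(skip x) -/(skip y) -/u1 -/u2.
have -> : n = (p i)%:Z * (-3 * w).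
  by rewrite /n N_signed_prod (signed_prod_factor_at p i) expr1 -/(skip _) -/w; ring.
clearbody u1 u2 w.
have sumE (z : 'I_t -> bool) : \sum_(j | j != i) (skip z j)%:R * [p j | i]
     = \sum_(j | j != i) (z j)%:R * [p j | i].
  by apply: eq_bigr => j ji; rewrite /skip ji.
have X (u : int) (e : bool) : (e -> ~~ (p i %| u)%Z) ->
    ~~ (p i %| u ^+ e)%Z /\ [u ^+ e | i] = e%:R * [u | i].
  exact: (@char_expb (legendre_add ^~ (p i)) (fun a => ~~ (p i %| a)%Z) (ndvd1 (p_prime i)) LM).
rewrite (bad_soluble _ (p_odd i) p3 (pM _ _ dN3 d0) d1 d2).
have dw := pM _ _ dN3 d0.
have [f1 g1] := X (-3)%R (y i) (fun _ => dN3).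
have [f2 g2] := X (-3 * w) (x i) (fun _ => dw).
have dNw : ~~ (p i %| - (-3 * w))%Z by rewrite rpredN.
have [f3 g3] := X (- (-3 * w)) (y i) (fun _ => dNw).
rewrite !is_sq_legendre ?pM //.
rewrite !LM ?pM // g1 g2 g3 L1 L2 !sumE.
have -> : [- (-3 * w) | i] = [3 | i] + \sum_(j | j != i) [p j | i].
  rewrite (_ : - (-3 * w) = 3 * w); last by ring.
  rewrite LM // L0 sumE !mul0r !add0r; congr (_ + _).
  by apply: eq_bigr => j _; rewrite mul1r.
have -> : [-3 * w | i] = [-3 | i] + \sum_(j | j != i) [p j | i].
  rewrite LM // L0 sumE !mul0r !add0r; congr (_ + _).
  by apply: eq_bigr => j _; rewrite mul1r.
by [].
Qed.
End LocalConditions.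

Lemma sqeq_odd_logn (m m' : int) q : m != 0 -> m' != 0 -> prime q ->
  sqeq (m%:~R : rat) m'%:~R -> odd (logn q `|m|) = odd (logn q `|m'|).
Proof.
move=> m0 m'0 q_pr [r r0 E].
have nq0 : numq r != 0 by rewrite numq_eq0.
have {}E : (`|m| * `|denq r| ^ 2 = `|m'| * `|numq r| ^ 2)%N.
  rewrite -!abszX -!abszM; congr absz; apply/eqP; rewrite -(eqr_int rat) !(rmorphXn, rmorphM) /= E.
  by rewrite numqE; apply/eqP; ring.
move: (congr1 (fun k => odd (logn q k)) E).
rewrite !lognM ?expn_gt0 ?absz_gt0 ?denq_neq0 ?nq0 ?m0 ?m'0 //.
by rewrite !oddD !addbb !addbF.
Qed.

(** * Integers representing square classes of rationals *)

Section Representatives.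
Variables (t : nat) (p : 'I_t -> nat).
Hypotheses (p_prime : forall i, prime (p i)) (p_inj : injective p).
Hypothesis p_neq23 : forall i, p i != 2%N /\ p i != 3%N.
Local Notation dec := (signed_prod p).

Lemma signed_prod_neq0 s a c x : dec s a c x != 0.
Proof.
rewrite /signed_prod !mulf_neq0 ?expf_neq0 ?oppr_eq0 ?oner_eq0 //.
by apply/prodf_neq0 => i _; rewrite expf_neq0 //; have := prime_gt0 (p_prime i); lia.
Qed.

Lemma signed_prod_lt0 s a c x : (dec s a c x < 0) = s.
Proof.
have pos : 0 < dec false a c x.
  rewrite /signed_prod expr0 mul1r !mulr_gt0 ?exprn_gt0 //.
  by apply: prodr_gt0 => i _; rewrite exprn_gt0 // ltz_nat prime_gt0.
have -> : dec s a c x = (-1) ^+ s * dec false a c x by rewrite /signed_prod expr0; ring.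
by case: s; rewrite ?expr1 ?expr0; lia.
Qed.

Lemma logn_signed_prod q s a c x : prime q ->
  logn q `|dec s a c x| = (a * (q == 2) + c * (q == 3) + \sum_i x i * (q == p i))%N.
Proof.
move=> q_pr; have pos i : (0 < p i ^ x i)%N by rewrite expn_gt0 prime_gt0.
have -> : `|dec s a c x|%N = (2 ^ a * 3 ^ c * \prod_i p i ^ x i)%N.
  rewrite /signed_prod !abszM !abszX exp1n mul1n (big_morph absz abszM absz1).
  by congr (_ * _)%N; apply: eq_bigr => i _; rewrite abszX.
have pp : (0 < \prod_i p i ^ x i)%N by apply: prodn_gt0.
rewrite !lognM ?muln_gt0 ?expn_gt0 // !lognX (@logn_prime q 2) // (@logn_prime q 3) //; congr (_ + _)%N.
elim/big_rec2: _ pp => [|i y1 y2 _ IH]; first by rewrite logn1.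
rewrite muln_gt0 => /andP[_ y20].
by rewrite lognM // lognX logn_prime // -IH.
Qed.

Lemma logn_signed_prod2 s a c x : logn 2 `|dec s a c x| = a.
Proof.
rewrite logn_signed_prod // muln1 muln0 addn0 big1 ?addn0 // => i _.
by have [p2 _] := p_neq23 i; rewrite eq_sym (negbTE p2) muln0.
Qed.

Lemma logn_signed_prod3 s a c x : logn 3 `|dec s a c x| = c.
Proof.
rewrite logn_signed_prod // muln1 muln0 add0n big1 ?addn0 // => i _.
by have [_ p3] := p_neq23 i; rewrite eq_sym (negbTE p3) muln0.
Qed.

Lemma logn_signed_prodp j s a c x : logn (p j) `|dec s a c x| = x j.
Proof.
have [p2 p3] := p_neq23 j.
rewrite logn_signed_prod // (negbTE p2) (negbTE p3) !muln0 !add0n (bigD1 j) //= eqxx muln1.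
by rewrite big1 ?addn0 // => i ij; rewrite (inj_eq p_inj) eq_sym (negbTE ij) muln0.
Qed.

(** The sign and the parities of the valuations depend only on the square class, and they recover
    all exponents. *)
Lemma signed_prod_sqeq_inj s a c x s' a' c' x' :
  sqeq ((dec s a c x)%:~R : rat) (dec s' a' c' x')%:~R ->
  [/\ s = s', a = a', c = c' & x =1 x'].
Proof.
move=> E; have od q q_pr := @sqeq_odd_logn _ _ q (signed_prod_neq0 s a c x) (signed_prod_neq0 s' a' c' x') q_pr E.
split.
- case: E => r r0 E; rewrite -(signed_prod_lt0 s a c x) -(signed_prod_lt0 s' a' c' x').
  have r2 : 0 < r ^+ 2 by rewrite exprn_even_gt0.
  by rewrite -(ltrz0 rat) E pmulr_llt0 // ltrz0.
- by have := od 2 isT; rewrite !logn_signed_prod2 !oddb.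
- by have := od 3 isT; rewrite !logn_signed_prod3 !oddb.
- by move=> i; have := od (p i) (p_prime i); rewrite !logn_signed_prodp !oddb.
Qed.

Lemma signed_prod_exists (m : int) : m != 0 ->
  (forall q, prime q -> q != 2 -> q != 3 -> (forall i, q != p i) -> ~~ odd (logn q `|m|)) ->
  exists s a c x, sqeq (m%:~R : rat) (dec s a c x)%:~R.
Proof.
move=> m0 H; pose s := m < 0; pose a := odd (logn 2 `|m|); pose c := odd (logn 3 `|m|).
pose x i := odd (logn (p i) `|m|); exists s, a, c, x; set D := dec s a c x.
have D0 : D != 0 by exact: signed_prod_neq0.
apply: sqeq_isq; rewrite ?intr_eq0 // -rmorphM.
(* D has the sign of m and the same parities of valuations, so |m| |D| has even valuation at every
   prime and m D is a square. *)
have [|q q_pr|r rE] := @even_logn_square (`|m| * `|D|)%N.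
- by rewrite muln_gt0 !absz_gt0 m0.
- rewrite lognM ?absz_gt0 // oddD.
  have [->|q2] := eqVneq q 2%N; first by rewrite logn_signed_prod2 oddb addbb.
  have [->|q3] := eqVneq q 3%N; first by rewrite logn_signed_prod3 oddb addbb.
  have [/existsP[i /eqP->]|nq] := boolP [exists i, q == p i].
    by rewrite logn_signed_prodp oddb addbb.
  rewrite negb_exists in nq; rewrite (negbTE (H q q_pr q2 q3 (forallP nq))) /D logn_signed_prod //.
  rewrite (negbTE q2) (negbTE q3) !muln0 !add0n big1 // => i _.
  by rewrite (negbTE (forallP nq i)) muln0.
exists (r%:Z)%:~R; rewrite -rmorphXn /=; congr (_%:~R).
rewrite -PoszXn -rE PoszM !abszEsign signed_prod_lt0 mulrACA -expr2 sqrr_sign mul1r //.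
Qed.
End Representatives.

(** * The Selmer group *)

Section Assembly.
Variables (R : realType) (t : nat) (p : 'I_t -> nat).
Hypotheses (p_prime : forall i, prime (p i)) (p_inj : injective p).
Hypothesis p_neq23 : forall i, p i != 2%N /\ p i != 3%N.
Local Notation dec := (signed_prod p).
Local Notation "[ d | i ]" := (legendre_add d (p i)) (format "[ d | i ]").

Let N : int := \prod_i (p i)%:Z.
Let n : int := - 3 * N.

Local Notation els b1 b2 := (everywhere_locally_soluble R 0 n%:~R (- 3 * n)%:~R b1 b2).
Local Notation dec1 v :=
  (dec (top v 3 != 0) (top v 4 != 0) (top v 5 != 0) (fun i => xpart v i != 0)).
Local Notation dec2 v :=
  (dec (top v 0 != 0) (top v 1 != 0) (top v 2 != 0) (fun i => ypart v i != 0)).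

Let N_gt0 : 0 < N.
Proof. by apply: prodr_gt0 => i _; rewrite ltz_nat prime_gt0. Qed.

Let R0 (m : int) : (m%:~R == 0 :> R) = (m == 0).
Proof. exact: intr_eq0. Qed.

Lemma elsP (b1 b2 : rat) : els b1 b2 <->
  solK (ratr b1 : R) (ratr b2) n%:~R /\
  forall q (q_pr : prime q), solK (ratr b1 : Qp q_pr) (ratr b2) n%:~R.
Proof.
split=> -[H1 H2]; split=> [|q q_pr].
- exact/(covering_solK R0).
- exact/(covering_solK (intrQp_eq0 q_pr))/H2.
- exact/(covering_solK R0).
- exact/(covering_solK (intrQp_eq0 q_pr))/H2.
Qed.

Lemma els_sqeq (b1 b2 b1' b2' : rat) : sqeq b1 b1' -> sqeq b2 b2' -> els b1 b2 -> els b1' b2'.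
Proof.
move=> E1 E2 /elsP[H1 H2]; apply/elsP; split=> [|q q_pr].
  by apply: solK_sqeq H1; [exact: ratr_sqeq|exact: ratr_sqeq|exact: sqeq_refl].
apply: solK_sqeq (H2 q q_pr); last exact: sqeq_refl.
  exact: (ratr_sqeq (intrQp_eq0 q_pr)).
exact: (ratr_sqeq (intrQp_eq0 q_pr)).
Qed.

Lemma ndvd_n q : prime q -> q != 2 -> q != 3 -> (forall i, q != p i) -> ~~ (q %| n)%Z.
Proof.
move=> q_pr q2 q3 qp; apply: ndvdM => //.
  by rewrite rpredN dvdzE /= dvdn_prime2.
rewrite /N; elim/big_rec: _ => [|i x _ H]; first exact: ndvd1.
by apply: ndvdM => //; rewrite dvdzE /= dvdn_prime2.
Qed.

Lemma odd_good q : prime q -> q != 2 -> odd q.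
Proof. by move=> q_pr q2; case: (even_prime q_pr) => // E; rewrite E in q2. Qed.

Lemma els_even (b1 b2 : rat) q (q_pr : prime q) : b1 != 0 -> b2 != 0 -> els b1 b2 ->
  q != 2 -> q != 3 -> (forall i, q != p i) ->
  ~~ odd (logn q `|numq b1 * denq b1|) /\ ~~ odd (logn q `|numq b2 * denq b2|).
Proof.
move=> b10 b20 /elsP[_ /(_ q q_pr) H] q2 q3 qp.
have red (b : rat) : b != 0 -> exists2 u : int, ~~ (q %| u)%Z &
    sqeq (ratr b : Qp q_pr) (q%:Z ^+ odd (logn q `|numq b * denq b|) * u)%:~R.
  move=> b0; have m0 : numq b * denq b != 0 by rewrite mulf_neq0 ?numq_eq0 ?denq_neq0.
  have [u qu mE] := int_val_parity q_pr m0; exists u => //.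
  apply: (sqeq_trans (ratr_sqeq (intrQp_eq0 q_pr) (sqeq_rat_int b))).
  rewrite ratr_int {1}mE rmorphM rmorphXn; exists ((q%:Z ^+ (logn q `|numq b * denq b|)./2)%:~R) => //.
  by rewrite intrQp_eq0 expf_neq0 //; have := prime_gt0 q_pr; lia.
have [u1 qu1 s1] := red _ b10; have [u2 qu2 s2] := red _ b20.
have [] := good_even_val (odd_good q_pr q2) q3 (ndvd_n q_pr q2 q3 qp) qu1 qu2
  (solK_sqeq s1 s2 (sqeq_refl _) H).
by move=> -> ->.
Qed.

(** Decoded integers are units at every prime outside 6N, so [good_soluble] leaves only the real
    place, 2, 3 and the p_i. *)
Lemma els_decP v : els (decode_b1 p v) (decode_b2 p v) <->
  [/\ top v 0 = 0,
      two_condition (top v 4 != 0) (top v 1 != 0)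
        (dec (top v 3 != 0) false (top v 5 != 0) (fun i => xpart v i != 0))
        (dec (top v 0 != 0) false (top v 2 != 0) (fun i => ypart v i != 0)) n,
      three_condition (top v 5 != 0) (top v 2 != 0)
        (dec (top v 3 != 0) (top v 4 != 0) false (fun i => xpart v i != 0))
        (dec (top v 0 != 0) (top v 1 != 0) false (fun i => ypart v i != 0)) (- N)
    & forall i, solK ((dec1 v)%:~R : Qp (p_prime i)) (dec2 v)%:~R n%:~R].
Proof.
rewrite elsP decode_b1E decode_b2E.
have E (K : fieldType) (a b : int) : solK (ratr a%:~R : K) (ratr b%:~R) n%:~R <->
   solK (a%:~R : K) b%:~R n%:~R by rewrite !ratr_int.
have real : solK ((dec1 v)%:~R : R) (dec2 v)%:~R n%:~R <-> top v 0 = 0.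
  rewrite real_solK ?R0 ?signed_prod_neq0 //; last by rewrite ltrz0 /n; lia.
  have d0 := signed_prod_neq0 p_prime (top v 0 != 0) (top v 1 != 0) (top v 2 != 0) (fun i => ypart v i != 0).
  rewrite ltr0z lt_def d0 /= leNgt signed_prod_lt0 // negbK; split=> [/eqP //|->]; exact: eqxx.
split=> [[/E H1 H2] | [H1 H2 H3 Hp]].
  split.
  - exact/real.
  - by have /E/soluble2 := H2 2 isT; apply.
  - by have /E/soluble3 := H2 3 isT; apply.
  - by move=> i; apply/E.
split=> [|q q_pr]; apply/E; first exact/real.
have [q2|q2] := eqVneq q 2%N; first by subst q; apply/soluble2.
have [q3|q3] := eqVneq q 3%N; first by subst q; apply/soluble3.
have [/existsP[i /eqP qi]|] := boolP [exists i, q == p i].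
  (* The type [Qp] depends on the proof of primality; the two proofs at hand are identified. *)
  by subst q; rewrite (Prop_irrelevance q_pr (p_prime i)).
rewrite negb_exists => /forallP qp.
have good s a c x : ~~ (q %| dec s a c x)%Z.
  (* The zero character is used: only the first conclusion, that q does not divide the product, is
     wanted. *)
  have [|||i _|//] := @char_signed_prod t p (fun=> 0) (fun a => ~~ (q %| a)%Z)
      (ndvd1 q_pr) (ndvdM q_pr) (fun _ _ _ _ => esym (addr0 _)) s a c x.
  - exact: ndvdN1.
  - by rewrite dvdzE /= dvdn_prime2.
  - by rewrite dvdzE /= dvdn_prime2.
  - by rewrite dvdzE /= dvdn_prime2.
by apply: good_soluble => //; [exact: odd_good | exact: ndvd_n].
Qed.

Lemma top_eqP (v w : 'cV['F_2]_(6 + (t + t))) :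
  (forall k, (k < 6)%N -> top v k = top w k) -> ypart v =1 ypart w -> xpart v =1 xpart w -> v = w.
Proof.
move=> H1 H2 H3; apply/matrixP => a b; rewrite !ord1.
have [i ->|i ->] := split_ordP a.
  by have := H1 i (ltn_ord i); rewrite /top inord_val.
by have [j ->|j ->] := split_ordP i; [exact: H2|exact: H3].
Qed.

Lemma square_class_sqeq (a b : rat) : a != 0 -> square_class a = square_class b <-> sqeq a b.
Proof.
move=> a0; split=> [E|[c c0 aE]].
  have : square_class a a by exists 1; rewrite ?oner_eq0 // expr1n mulr1.
  by rewrite E => -[c c0 ->]; exists c.
apply/seteqP; split=> x [d d0 ->].
  by exists (c * d); rewrite ?mulf_neq0 // aE; ring.
by exists (d / c); rewrite ?mulf_neq0 ?invr_eq0 // aE; field.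
Qed.

Lemma F2_bool_inj (a b : 'F_2) : (a != 0) = (b != 0) -> a = b.
Proof. by rewrite {2}[a]F2_boolE {2}[b]F2_boolE => ->. Qed.

Lemma F2_boolK (b : bool) : ((b%:R : 'F_2) != 0) = b.
Proof. by case: b. Qed.

(** Decoding is injective on square classes, and it reaches every locally soluble pair because
    [els_even] excludes odd valuations at the primes outside 6N. *)
Lemma Monsky_of_els (M : 'M['F_2]_(6 + (t + t))) :
  (forall v, M *m v = 0 <-> els (decode_b1 p v) (decode_b2 p v)) ->
  is_Monsky_matrix p R n M.
Proof.
move=> MP.
have b1nz v : decode_b1 p v != 0 by rewrite decode_b1E intr_eq0 signed_prod_neq0.
have b2nz v : decode_b2 p v != 0 by rewrite decode_b2E intr_eq0 signed_prod_neq0.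
split.
- move=> v /MP ev; exists (decode_b1 p v), (decode_b2 p v).
  by split.
- move=> v w _ _ [/square_class_sqeq E1 /square_class_sqeq E2].
  have {}E1 := E1 (b1nz _); have {}E2 := E2 (b2nz _).
  rewrite !decode_b1E in E1; rewrite !decode_b2E in E2.
  have [/F2_bool_inj e3' /F2_bool_inj e4' /F2_bool_inj e5' ex] := signed_prod_sqeq_inj p_prime p_inj p_neq23 E1.
  have [/F2_bool_inj e0' /F2_bool_inj e1' /F2_bool_inj e2' ey] := signed_prod_sqeq_inj p_prime p_inj p_neq23 E2.
  apply: top_eqP; first by case=> [|[|[|[|[|[|]]]]]].
    by move=> i; exact/F2_bool_inj/ey.
  by move=> i; exact/F2_bool_inj/ex.
move=> _ [b1 [b2 [b10 b20 el ->]]].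
have rep (b : rat) : b != 0 -> (forall q, prime q -> q != 2 -> q != 3 -> (forall i, q != p i) ->
    ~~ odd (logn q `|numq b * denq b|)) -> exists s a c x, sqeq b (dec s a c x)%:~R.
  move=> b0 /signed_prod_exists[||//||s [a [c [x sx]]]] //.
    by rewrite mulf_neq0 ?numq_eq0 ?denq_neq0.
  by exists s, a, c, x; exact: sqeq_trans (sqeq_rat_int b) sx.
have [|s1 [a1 [c1 [x S1]]]] := rep b1 b10.
  by move=> q q_pr q2 q3 qp; have [] := els_even q_pr b10 b20 el q2 q3 qp.
have [|s2 [a2 [c2 [y S2]]]] := rep b2 b20.
  by move=> q q_pr q2 q3 qp; have [] := els_even q_pr b10 b20 el q2 q3 qp.
pose v : 'cV['F_2]_(6 + (t + t)) :=
  col_mx (\col_(k < 6) [:: s2%:R; a2%:R; c2%:R; s1%:R; a1%:R; c1%:R]`_k)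
    (col_mx (\col_i (y i)%:R) (\col_i (x i)%:R)).
have tv k : (k < 6)%N -> top v k = [:: s2%:R; a2%:R; c2%:R; s1%:R; a1%:R; c1%:R]`_k.
  by move=> k6; rewrite /top /v col_mxEu mxE inordK.
have yv i : ypart v i = (y i)%:R by rewrite /ypart /v col_mxEd col_mxEu mxE.
have xv i : xpart v i = (x i)%:R by rewrite /xpart /v !col_mxEd mxE.
have d1 : decode_b1 p v = (dec s1 a1 c1 x)%:~R.
  rewrite decode_b1E !tv //= !F2_boolK; congr (_%:~R); rewrite /signed_prod; congr (_ * _).
  by apply: eq_bigr => i _; rewrite xv F2_boolK.
have d2 : decode_b2 p v = (dec s2 a2 c2 y)%:~R.
  rewrite decode_b2E !tv //= !F2_boolK; congr (_%:~R); rewrite /signed_prod; congr (_ * _).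
  by apply: eq_bigr => i _; rewrite yv F2_boolK.
rewrite -d1 in S1; rewrite -d2 in S2.
exists v; first by apply/MP; exact: els_sqeq S1 S2 el.
by congr (_, _); apply/square_class_sqeq => //; exact: sqeq_sym.
Qed.

End Assembly.

(** * The local conditions as rows of the three matrices *)

Section Rows.
Variables (R : realType) (t : nat) (p : 'I_t -> nat).
Hypotheses (p_prime : forall i, prime (p i)) (p_inj : injective p).
Hypothesis p_neq23 : forall i, p i != 2%N /\ p i != 3%N.
Local Notation dec := (signed_prod p).
Local Notation "[ d | i ]" := (legendre_add d (p i)) (format "[ d | i ]").

Let N : int := \prod_i (p i)%:Z.
Let n : int := - 3 * N.

Variable v : 'cV['F_2]_(6 + (t + t)).
Local Notation X d := (\sum_i legendre_add d (p i) * xpart v i).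
Local Notation Y d := (\sum_i legendre_add d (p i) * ypart v i).
Local Notation s := (legendre_tilde p (-3)).

Lemma row_eq_mx ul (a b : 'rV_t) : row_eq v ul (row_mx a b) =
  (ul`_0 * top v 0 + ul`_1 * top v 1 + ul`_2 * top v 2 + ul`_3 * top v 3
   + ul`_4 * top v 4 + ul`_5 * top v 5
   + (\sum_i a 0 i * ypart v i + \sum_i b 0 i * xpart v i) = 0).
Proof. by rewrite /row_eq row_dotE. Qed.

Lemma dot0 (z : 'I_t -> 'F_2) : \sum_i (0 : 'rV['F_2]_t) 0 i * z i = 0.
Proof. by rewrite big1 // => i _; rewrite mxE mul0r. Qed.

Lemma dot_r d (z : 'I_t -> 'F_2) : \sum_i (r_ p d) 0 i * z i = \sum_i [d | i] * z i.
Proof. by apply: eq_bigr => i _; rewrite mxE. Qed.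

Lemma sum_bool d (z : 'I_t -> 'F_2) :
  \sum_i (z i != 0)%:R * [d | i] = \sum_i [d | i] * z i.
Proof. by apply: eq_bigr => i _; rewrite -F2_boolE mulrC. Qed.

Lemma rows6 (P : nat -> Prop) :
  (forall k, (k < 6)%N -> P k) <-> [/\ P 0, P 1, P 2, P 3 & P 4 /\ P 5]%N.
Proof.
split=> [H|[H0 H1 H2 H3 [H4 H5]] [|[|[|[|[|[|]]]]]] //].
by split; [| | | |split]; apply: H.
Qed.

(** For n = 3 nu one has -nu = N, and [e3 N] equals [-3/N] by reciprocity at each p_i; this is the
    origin of the entry [s] in the fifth and sixth rows. *)
Lemma three_conditionE :
  three_condition (top v 5 != 0) (top v 2 != 0)
    (dec (top v 3 != 0) (top v 4 != 0) false (fun i => xpart v i != 0))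
    (dec (top v 0 != 0) (top v 1 != 0) false (fun i => ypart v i != 0)) (- N) <->
  top v 0 + top v 1 + s * top v 2 + Y (-3) = 0 /\
  s * top v 2 + top v 3 + top v 4 + (1 + s) * top v 5 + X (-3) = 0.
Proof.
rewrite /three_condition opprK.
have -> : e3 N = s.
  rewrite /N N_signed_prod; have [_ ->] := e3_signed_prod p_prime p_neq23 false false (fun => true).
  by rewrite !add0r; apply: eq_bigr => i _; rewrite mul1r.
have [_ ->] := e3_signed_prod p_prime p_neq23 (top v 3 != 0) (top v 4 != 0) (fun i => xpart v i != 0).
have [_ ->] := e3_signed_prod p_prime p_neq23 (top v 0 != 0) (top v 1 != 0) (fun i => ypart v i != 0).
rewrite !sum_bool -!F2_boolE; split.
  by case/andP => /eqP H5 /eqP H6; split; [rewrite -[RHS]H5|rewrite -[RHS]H6]; ring.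
by case=> H5 H6; apply/andP; split; apply/eqP; [rewrite -[RHS]H5|rewrite -[RHS]H6]; ring.
Qed.

Lemma bad_rowsE :
  (forall i, solK ((dec (top v 3 != 0) (top v 4 != 0) (top v 5 != 0)
       (fun i => xpart v i != 0))%:~R : Qp (p_prime i))
     (dec (top v 0 != 0) (top v 1 != 0) (top v 2 != 0) (fun i => ypart v i != 0))%:~R n%:~R) <->
  (forall i, [-1 | i] * top v 3 + [2 | i] * top v 4 + [3 | i] * top v 5
        + [-3 | i] * ypart v i + (A_dot p (xpart v) i + [-3 | i] * xpart v i) = 0) /\
  (forall i, [-1 | i] * top v 0 + [2 | i] * top v 1 + [3 | i] * top v 2
        + (A_dot p (ypart v) i + [3 | i] * ypart v i) = 0).
Proof.
have sumE i (z : 'I_t -> 'F_2) : \sum_(j | j != i) (z j != 0)%:R * [p j | i]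
    = \sum_(j | j != i) [p j | i] * z j.
  by apply: eq_bigr => j _; rewrite -F2_boolE mulrC.
have E i := solublep p_prime p_inj p_neq23 i (top v 3 != 0) (top v 4 != 0) (top v 5 != 0)
  (fun i => xpart v i != 0) (top v 0 != 0) (top v 1 != 0) (top v 2 != 0) (fun i => ypart v i != 0).
split=> [H | [H7 H8] i].
  by split=> i; have /E := H i; rewrite !sumE -!F2_boolE /A_dot => -[H7 H8];
    [rewrite -[RHS]H7 | rewrite -[RHS]H8]; ring.
apply/E; rewrite !sumE -!F2_boolE; have := H7 i; have := H8 i; rewrite /A_dot => h8 h7.
by split; [rewrite -[RHS]h7 | rewrite -[RHS]h8]; ring.
Qed.

Local Notation two := (two_condition (top v 4 != 0) (top v 1 != 0)
  (dec (top v 3 != 0) false (top v 5 != 0) (fun i => xpart v i != 0))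
  (dec (top v 0 != 0) false (top v 2 != 0) (fun i => ypart v i != 0)) n).

Let F2_negb (z : 'F_2) : ~~ (z != 0) = (z == 0).
Proof. exact: negbK. Qed.

(** The three matrices share all rows from the fifth on. Only the first four, real and 2-adic,
    depend on N modulo 8, so they alone are left as a hypothesis. *)
Lemma kernel_elsP ul ur :
  [/\ row_eq v (nth [::] ul 0) (nth 0 ur 0), row_eq v (nth [::] ul 1) (nth 0 ur 1),
      row_eq v (nth [::] ul 2) (nth 0 ur 2) & row_eq v (nth [::] ul 3) (nth 0 ur 3)] <->
    top v 0 = 0 /\ two ->
  nth [::] ul 4 = [:: 1; 1; s; 0; 0; 0] -> nth [::] ul 5 = [:: 0; 0; s; 1; 1; 1 + s] ->
  nth 0 ur 4 = row_mx (r_ p (-3)) 0 -> nth 0 ur 5 = row_mx 0 (r_ p (-3)) ->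
  C_matrix p ul ur *m v = 0 <->
  everywhere_locally_soluble R 0 n%:~R (- 3 * n)%:~R (decode_b1 p v) (decode_b2 p v).
Proof.
move=> E2 l4 l5 r4 r5.
have E3 : row_eq v (nth [::] ul 4) (nth 0 ur 4) /\ row_eq v (nth [::] ul 5) (nth 0 ur 5) <->
    top v 0 + top v 1 + s * top v 2 + Y (-3) = 0 /\
    s * top v 2 + top v 3 + top v 4 + (1 + s) * top v 5 + X (-3) = 0.
  rewrite l4 l5 r4 r5 !row_eq_mx /= !dot0 !dot_r.
  by rewrite !mul1r !mul0r !addr0 !add0r.
split=> [/C_kernelP[/rows6[h0 h1 h2 h3 /E3/three_conditionE h45] h7 h8] |
         /(els_decP R p_prime p_neq23)[h0 h2 /three_conditionE/E3 h45 /bad_rowsE[h7 h8]]].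
  apply/(els_decP R p_prime p_neq23); have [t0 tw] := E2.1 (And4 h0 h1 h2 h3).
  by split=> //; exact/bad_rowsE.
have [k0 k1 k2 k3] := E2.2 (conj h0 h2).
by apply/C_kernelP; split=> //; apply/rows6.
Qed.

Lemma two_condition1 : (N %% 8)%Z = 1 -> two <->
  [/\ top v 4 = 0, top v 1 = 0 & top v 3 + top v 5 + X (-1) = 0].
Proof.
move=> N8; have n8 : (n %% 8)%Z = 5 by rewrite /n; lia.
rewrite /two_condition n8 /= !F2_negb e4_signed_prod // !sum_bool -!F2_boolE.
by split=> [/and3P[/eqP-> /eqP-> /eqP->]|[-> -> ->]] //; rewrite !eqxx.
Qed.

Lemma two_condition5 : (N %% 8)%Z = 5 -> two <->
  [/\ top v 4 = 0, top v 1 + top v 3 + top v 5 + X (-1) = 0 &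
      top v 0 + top v 1 + top v 2 + top v 5 + (Y (-1) + X 2) = 0].
Proof.
move=> N8; have n8 : (n %% 8)%Z = 1 by rewrite /n; lia.
rewrite /two_condition n8 /= !F2_negb !e4_signed_prod // e8_signed_prod // !sum_bool -!F2_boolE.
split=> [/and3P[/eqP-> /eqP E1 /eqP E2]|[-> E1 E2]].
  by split=> //; [rewrite -[RHS]E1|rewrite -[RHS]E2]; ring.
by rewrite eqxx /=; apply/andP; split; apply/eqP; [rewrite -[RHS]E1|rewrite -[RHS]E2]; ring.
Qed.

Lemma two_condition3 : (N %% 4)%Z = 3 -> two <->
  [/\ top v 4 = 0, top v 1 = 0 & top v 0 + top v 2 + Y (-1) = 0].
Proof.
move=> N8; have n5 : ((n %% 8)%Z == 5) = false by rewrite /n; lia.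
have n1 : ((n %% 8)%Z == 1) = false by rewrite /n; lia.
rewrite /two_condition n5 n1 !F2_negb e4_signed_prod // !sum_bool -!F2_boolE.
by split=> [/and3P[/eqP-> /eqP-> /eqP->]|[-> -> ->]] //; rewrite !eqxx.
Qed.

Lemma C4_elsP : (N %% 8)%Z = 1 -> C4 p *m v = 0 <->
  everywhere_locally_soluble R 0 n%:~R (- 3 * n)%:~R (decode_b1 p v) (decode_b2 p v).
Proof.
move=> N8; apply: kernel_elsP => //; rewrite two_condition1 // !row_eq_mx /= !dot0 !dot_r.
rewrite !mul1r !mul0r !addr0 !add0r.
by split=> [[-> -> -> ->]|[-> [-> -> ->]]].
Qed.

Lemma C5_elsP : (N %% 8)%Z = 5 -> C5 p *m v = 0 <->
  everywhere_locally_soluble R 0 n%:~R (- 3 * n)%:~R (decode_b1 p v) (decode_b2 p v).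
Proof.
move=> N8; apply: kernel_elsP => //; rewrite two_condition5 // !row_eq_mx /= !dot0 !dot_r.
rewrite !mul1r !mul0r !addr0 !add0r.
by split=> [[-> -> -> ->]|[-> [-> -> ->]]].
Qed.

Lemma C6_elsP : (N %% 4)%Z = 3 -> C6 p *m v = 0 <->
  everywhere_locally_soluble R 0 n%:~R (- 3 * n)%:~R (decode_b1 p v) (decode_b2 p v).
Proof.
move=> N8; apply: kernel_elsP => //; rewrite two_condition3 // !row_eq_mx /= !dot0 !dot_r.
rewrite !mul1r !mul0r !addr0 !add0r.
by split=> [[-> -> -> ->]|[-> [-> -> ->]]].
Qed.

End Rows.

Theorem theorem6p20 (R : realType) (t : nat) (p : 'I_t -> nat)
    (p_prime : forall i, prime (p i)) (p_inj : injective p)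
    (p_neq23 : forall i, p i != 2%N /\ p i != 3%N)
    (ntilde : nat) (ntildeE : ntilde = (\prod_(i < t) p i)%N)
    (n : int) (nE : n = - 3 * ntilde%:Z) :
  [/\ (ntilde = 1 %[mod 8])%N -> is_Monsky_matrix p R n (C4 p),
      (ntilde = 5 %[mod 8])%N -> is_Monsky_matrix p R n (C5 p)
    & (ntilde = 3 %[mod 4])%N -> is_Monsky_matrix p R n (C6 p)].
Proof.
have NE : \prod_i (p i)%:Z = ntilde%:Z by rewrite ntildeE (big_morph Posz PoszM (erefl _)).
rewrite nE -NE; split=> Nmod; apply: Monsky_of_els => // v.
- by apply: C4_elsP => //; rewrite NE; lia.
- by apply: C5_elsP => //; rewrite NE; lia.
- by apply: C6_elsP => //; rewrite NE; lia.
Qed.
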